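(* Let $\beta\neq 0$ and $\alpha$ be real numbers such that Mathieu's equation $$\frac{d^2u}{d\theta^2}+(\alpha+\beta\cos\theta)u(\theta)=0$$ has a real periodic solution $u$ with period $2\pi$ or $4\pi$, and suppose that $u$ has Fourier expansion $u(\theta)=\sum_{n=-\infty}^\infty b_ne^{in\theta}$. Let $\Gamma_u$ be the Hankel matrix $[b_{j+k-1}]_{j,k=1}^\infty$, let $\Gamma_v$ be the Hankel matrix $[(j+k-1)b_{j+k-1}]_{j,k=1}^\infty$, and let $$K=\frac{2}{\beta}\bigl(\Gamma_u\Gamma_v+\Gamma_v\Gamma_u\bigr).$$ Then $K$ is a trace class operator on $\ell^2(\mathbf{N})$ such that $$\mathrm{trace}(K)=\frac{1}{\beta\pi}\int_0^{2\pi}\Bigl\vert\frac{du}{d\theta}\Bigr\vert^2\,d\theta$$ and $$K(j,k)=\frac{b_{j-1}b_k-b_jb_{k-1}}{j-k}\qquad (j,k\in\mathbf{N};\ j\neq k).$$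
   Context: $\mathbf{N}=\{1,2,3,\dots\}$. $K(j,k)$ denotes the $(j,k)$ entry of the matrix of $K$ in the usual orthonormal basis of $\ell^2(\mathbf{N})$.
   Formalization: The trace formula is stated only when all Fourier coefficients b_n are real (u even); as printed it fails for nonzero odd u, whose b_n are purely imaginary, so that the two sides have opposite signs. *)

(* Defs.v *)
From Stdlib Require Import Reals ZArith.
From Coquelicot Require Import Coquelicot.
Open Scope R_scope.

(** * Mathieu's equation and Fourier expansions *)

Definition mathieu_solution (alpha beta : R) (u : R -> R) : Prop :=
  (forall t, ex_derive u t) /\
  (forall t, ex_derive (Derive u) t) /\
  (forall t, Derive (Derive u) t + (alpha + beta * cos t) * u t = 0).

Definition periodic (p : R) (u : R -> R) : Prop := forall t, u (t + p) = u t.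

(** [cis t] is exp(it). *)
Definition cis (t : R) : C := (cos t, sin t).

(** [fourier_partial b N t] is the sum of b_n exp(int) over -N <= n <= N. *)
Definition fourier_partial (b : Z -> C) (N : nat) (t : R) : C :=
  sum_n (fun m : nat =>
           let n := (Z.of_nat m - Z.of_nat N)%Z in
           Cmult (b n) (cis (IZR n * t)))
        (2 * N).

Definition fourier_expansion (u : R -> R) (b : Z -> C) : Prop :=
  (forall n : Z,
     b n = Cmult (RtoC (/ (2 * PI)))
             (RInt (V := C_R_CompleteNormedModule)
                (fun t => Cmult (RtoC (u t)) (cis (- (IZR n * t)))) 0 (2 * PI)))
  /\
  (forall t : R,
     filterlim (fun N => fourier_partial b N t) eventually
               (locally (RtoC (u t)))).

(** * Operators on l^2({1,2,3,...})

    A vector is a complex sequence [x : nat -> C] satisfying [in_l2 x], where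
    [x n] is the coordinate of index [idx n] = n + 1.  An operator is a map on
    sequences of which only the values on l^2 matter. *)

Definition idx (n : nat) : Z := (Z.of_nat n + 1)%Z.

Definition in_l2 (x : nat -> C) : Prop := ex_series (fun n => Cmod (x n) ^ 2).

Definition l2_norm (x : nat -> C) : R :=
  sqrt (Series (fun n => Cmod (x n) ^ 2)).

Definition operator := (nat -> C) -> nat -> C.

Definition op_sub (T F : operator) : operator :=
  fun x n => Cminus (T x n) (F x n).

Definition bounded_operator (T : operator) : Prop :=
  (forall (c : C) (x y : nat -> C), in_l2 x -> in_l2 y ->
     forall n, T (fun m => Cplus (Cmult c (x m)) (y m)) n
               = Cplus (Cmult c (T x n)) (T y n)) /\
  (exists M : R, forall x, in_l2 x ->
     in_l2 (T x) /\ l2_norm (T x) <= M * l2_norm x).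

Definition op_norm (T : operator) : R :=
  real (Lub_Rbar (fun r => exists x, in_l2 x /\ l2_norm x <= 1 /\
                                     r = l2_norm (T x))).

(** The range of [F] on l^2 lies in the span of n vectors of l^2. *)
Definition rank_le (n : nat) (F : operator) : Prop :=
  exists y : nat -> nat -> C,
    (forall i, in_l2 (y i)) /\
    forall x, in_l2 x -> exists c : nat -> C,
      forall j, F x j = sum_n_m (fun i => Cmult (c i) (y i j)) 1 n.

(** Singular numbers, as distances in operator norm to the operators of rank
    at most n; thus [singular_number T 0] is the norm of [T]. *)
Definition singular_number (T : operator) (n : nat) : R :=
  real (Glb_Rbar (fun r => exists F, bounded_operator F /\ rank_le n F /\
                                     r = op_norm (op_sub T F))).

Definition trace_class (T : operator) : Prop :=
  bounded_operator T /\ ex_series (singular_number T).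

Definition basis_vector (k : nat) : nat -> C :=
  fun n => if Nat.eqb n k then RtoC 1 else RtoC 0.

(** The matrix entry <T e_k, e_j>; it is the (idx j, idx k) entry. *)
Definition entry (T : operator) (j k : nat) : C := T (basis_vector k) j.

Definition is_trace (T : operator) (t : C) : Prop :=
  is_series (V := C_R_NormedModule) (fun n => entry T n n) t.

(** Coquelicot's total [Series] is real-valued. *)
Definition CSeries (a : nat -> C) : C :=
  (Series (fun n => Re (a n)), Series (fun n => Im (a n))).

Definition hankel (a : Z -> C) : operator :=
  fun x j => CSeries (fun k => Cmult (a (idx j + idx k - 1)%Z) (x k)).

Definition mathieu_K (beta : R) (b : Z -> C) : operator :=
  let Gu := hankel b in
  let Gv := hankel (fun n => Cmult (RtoC (IZR n)) (b n)) in
  fun x j => Cmult (RtoC (2 / beta)) (Cplus (Gu (Gv x) j) (Gv (Gu x) j)).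

(* Main.v *)
Require Import Defs.
From Stdlib Require Import Reals ZArith Lra Lia.
From Coquelicot Require Import Coquelicot.
Open Scope R_scope.

(** Integrating Mathieu's equation against [exp(-int)] gives the three-term
    recurrence [n^2 b_n = alpha b_n + (beta/2) (b_(n-1) + b_(n+1))]
    ([coefficient_recurrence]); everything about [K] follows from it.

    The recurrence trades bounds on [b] for decay: from bounded coefficients it
    yields [b_n = O(n^-2)], and each further use gains two more powers
    ([recurrence_decay_step]). With [b_n = O(n^-6)] both Hankel matrices send
    bounded sequences to sequences of size [O(j^-3)] ([hankel_bound]), hence so
    does [K]. Truncating the output of [K] to [n] coordinates is then an
    approximation of rank at most [n] with error [O(n^-2)], so the singular
    numbers are summable ([smoothing_trace_class]).

    With 1-based indices [J], [K], the matrix entry of the operator is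
    [(2/beta)] times the sum over [m >= 0] of
    [(J + K + 2m) b_(J+m) b_(K+m)]. Multiplying by [J - K] produces
    [(J+m)^2 - (K+m)^2], and the recurrence rewrites the terms as differences
    of consecutive values of [b_(J+m-1) b_(K+m) - b_(J+m) b_(K+m-1)]. The sum
    telescopes to the value at [m = 0] ([mathieu_K_off_diagonal]).

    On the diagonal the entries are tails of the series of [(4/beta) n b_n^2],
    whose sum is [(4/beta)] times the sum over [n >= 1] of [n^2 b_n^2]
    ([is_series_tails], [mathieu_K_trace]). For real coefficients this is
    Parseval's formula for [u'] ([parseval_derivative]): the integral of [u'^2]
    equals that of [- u'' u], and the cosine series of [u], which converges
    uniformly, can be integrated term by term against [- u'']. *)

(** * Series *)

Lemma INR1_pos (n : nat) : 0 < INR n + 1.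
Proof. pose proof (pos_INR n); lra. Qed.

(** Comparison with the telescoping sum of [1/n - 1/(n+1)] bounds the partial
    sums by [2 - 1/(n+1)]. *)
Lemma ex_series_inv_square : ex_series (fun n => / (INR n + 1) ^ 2).
Proof.
  assert (Hincr : forall n, sum_n (fun k => / (INR k + 1) ^ 2) n <=
                            sum_n (fun k => / (INR k + 1) ^ 2) (S n)).
  { intro n. rewrite sum_Sn. unfold plus; simpl plus.
    assert (0 < / (INR (S n) + 1) ^ 2)
      by (apply Rinv_0_lt_compat, pow_lt, INR1_pos).
    change plus with Rplus. simpl in *. lra. }
  assert (Hbound : forall n, sum_n (fun k => / (INR k + 1) ^ 2) n <= 2 - / (INR n + 1)).
  { induction n as [|n IH].
    - rewrite sum_O. simpl. lra.
    - rewrite sum_Sn. change plus with Rplus. cbv beta. rewrite S_INR.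
      pose proof (INR1_pos n) as H.
      apply Rle_trans with (2 - / (INR n + 1) + / (INR n + 1 + 1) ^ 2); [lra|].
      assert (/ (INR n + 1) - / (INR n + 1 + 1) - / (INR n + 1 + 1) ^ 2
              = / ((INR n + 1) * (INR n + 1 + 1) ^ 2)) by (field; lra).
      assert (0 < / ((INR n + 1) * (INR n + 1 + 1) ^ 2)).
      { apply Rinv_0_lt_compat. apply Rmult_lt_0_compat; [lra|]. apply pow_lt; lra. }
      lra. }
  destruct (ex_finite_lim_seq_incr _ 2 Hincr) as [l Hl].
  { intro n. pose proof (Hbound n).
    assert (0 < / (INR n + 1)) by (apply Rinv_0_lt_compat, INR1_pos). lra. }
  exists l. exact Hl.
Qed.

Definition inv_square_sum : R := Series (fun n => / (INR n + 1) ^ 2).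

Lemma Series_single (f : nat -> R) (k : nat) :
  (forall n, n <> k -> f n = 0) -> is_series f (f k).
Proof.
  intro H. apply (filterlim_ext_loc (fun _ => f k)); [|apply filterlim_const].
  exists k. intros n Hn.
  assert (Hlt : forall m, (m < k)%nat -> sum_n f m = 0).
  { induction m as [|m IH]; intro Hm.
    - rewrite sum_O. apply H. lia.
    - rewrite sum_Sn, IH by lia. rewrite H by lia. apply Rplus_0_l. }
  assert (Hk : sum_n f k = f k).
  { destruct k as [|k]; [apply sum_O|].
    rewrite sum_Sn, Hlt by lia. apply Rplus_0_l. }
  induction n as [|n IH].
  - assert (k = 0%nat) by lia. subst k. now symmetry.
  - destruct (Nat.eq_dec k (S n)) as [<-|Hne]; [now symmetry|].
    rewrite sum_Sn, <- IH by lia. rewrite (H (S n)) by lia.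
    symmetry; apply Rplus_0_r.
Qed.

Lemma Series_zero (f : nat -> R) : (forall n, f n = 0) -> Series f = 0.
Proof.
  intro H. rewrite <- (H 0%nat). apply is_series_unique, Series_single.
  intros n _. apply H.
Qed.

Lemma inv_square_sum_pos : 0 <= inv_square_sum.
Proof.
  unfold inv_square_sum. rewrite <- (Series_zero (fun _ => 0)) by reflexivity.
  apply Series_le; [|apply ex_series_inv_square].
  intro n. split; [lra|]. left. apply Rinv_0_lt_compat, pow_lt, INR1_pos.
Qed.

Lemma is_series_telescoping (D : nat -> R) :
  is_lim_seq D 0 -> is_series (fun n => D n - D (S n)) (D 0%nat).
Proof.
  intro HD.
  assert (Hs : forall n, sum_n (fun n => D n - D (S n)) n = D 0%nat - D (S n)).
  { induction n as [|n IH]; [now rewrite sum_O|].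
    rewrite sum_Sn, IH. change plus with Rplus. simpl. ring. }
  change (is_lim_seq (sum_n (fun n => D n - D (S n))) (D 0%nat)).
  apply (is_lim_seq_ext (fun n => D 0%nat - D (S n))).
  - intro n. now rewrite Hs.
  - replace (Finite (D 0%nat)) with (Finite (D 0%nat - 0)) by (f_equal; ring).
    apply (is_lim_seq_minus' (fun _ => D 0%nat) (fun n => D (S n))).
    + apply is_lim_seq_const.
    + now apply is_lim_seq_incr_1 in HD.
Qed.

Lemma is_lim_seq_scal_inv (A : R) : is_lim_seq (fun n => A / (INR n + 1)) 0.
Proof.
  apply is_lim_seq_ext with (fun n => A * / INR (S n)).
  - intro n. now rewrite S_INR.
  - replace (Finite 0) with (Rbar_mult A (Rbar_inv p_infty))
      by (simpl; f_equal; ring).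
    apply is_lim_seq_scal_l. apply is_lim_seq_inv; [|discriminate].
    apply -> is_lim_seq_incr_1. apply is_lim_seq_INR.
Qed.

Lemma is_lim_seq_bounded_inv (D : nat -> R) (A : R) :
  (forall n, Rabs (D n) <= A / (INR n + 1)) -> is_lim_seq D 0.
Proof.
  intro H. apply is_lim_seq_abs_0.
  apply is_lim_seq_le_le with (fun _ => 0) (fun n => A / (INR n + 1)).
  - intro n. split; [apply Rabs_pos|apply H].
  - apply is_lim_seq_const.
  - apply is_lim_seq_scal_inv.
Qed.

(** A factor of the fifth power of [j + m + 2] is split as a cube of [j + 1]
    times a square of [m + 1], which leaves a summable sequence in [m]. *)
Lemma inv_pow5_split (j m : nat) :
  / (INR (j + m) + 2) ^ 5 <= / (INR j + 1) ^ 3 * / (INR m + 1) ^ 2.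
Proof.
  rewrite plus_INR, <- Rinv_mult.
  pose proof (pos_INR j). pose proof (pos_INR m).
  assert (0 < (INR j + 1) ^ 3) by (apply pow_lt; lra).
  assert (0 < (INR m + 1) ^ 2) by (apply pow_lt; lra).
  apply Rinv_le_contravar; [now apply Rmult_lt_0_compat|].
  replace ((INR j + INR m + 2) ^ 5)
    with ((INR j + INR m + 2) ^ 3 * (INR j + INR m + 2) ^ 2) by ring.
  apply Rmult_le_compat; try lra; apply pow_incr; lra.
Qed.

Lemma Series_abs_le (f B : nat -> R) :
  (forall n, Rabs (f n) <= B n) -> ex_series B ->
  ex_series f /\ Rabs (Series f) <= Series B.
Proof.
  intros Hle HB.
  assert (Habs : ex_series (fun n => Rabs (f n))).
  { apply (ex_series_le (V := R_CompleteNormedModule) _ B); [|exact HB].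
    intro n. change norm with Rabs. simpl. now rewrite Rabs_Rabsolu. }
  split; [now apply ex_series_Rabs|].
  apply Rle_trans with (Series (fun n => Rabs (f n))); [now apply Series_Rabs|].
  apply Series_le; [|exact HB].
  intro n. split; [apply Rabs_pos|apply Hle].
Qed.

Lemma Series_pow5_tail (f : nat -> R) (A : R) (j : nat) :
  0 <= A -> (forall m, Rabs (f m) <= A / (INR (j + m) + 2) ^ 5) ->
  ex_series f /\ Rabs (Series f) <= A * inv_square_sum / (INR j + 1) ^ 3.
Proof.
  intros HA Hf.
  replace (A * inv_square_sum / (INR j + 1) ^ 3)
    with (Series (fun m => A / (INR j + 1) ^ 3 * / (INR m + 1) ^ 2)).
  - apply Series_abs_le.
    + intro m. eapply Rle_trans; [apply Hf|]. unfold Rdiv.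
      rewrite Rmult_assoc. apply Rmult_le_compat_l; [exact HA|].
      apply inv_pow5_split.
    + apply (ex_series_scal_l (V := R_NormedModule) (A / (INR j + 1) ^ 3) (fun m => / (INR m + 1) ^ 2)), ex_series_inv_square.
  - rewrite Series_scal_l. unfold inv_square_sum. field.
    pose proof (INR1_pos j); lra.
Qed.

(** * Complex series *)

Definition summable (a : nat -> C) : Prop := ex_series (fun n => Cmod (a n)).

Lemma Im_le_Cmod (c : C) : Rabs (Im c) <= Cmod c.
Proof.
  eapply Rle_trans; [apply Rmax_r|apply Rmax_Cmod].
Qed.

(** Bounds real and imaginary parts separately, so that real series suffice;
    the lost constant is harmless. *)
Lemma Cmod_le_sum (c : C) : Cmod c <= Rabs (Re c) + Rabs (Im c).
Proof.
  replace c with (Cplus (RtoC (Re c)) (Cmult Ci (RtoC (Im c)))) at 1.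
  - eapply Rle_trans; [apply Cmod_triangle|].
    rewrite Cmod_mult, Cmod_Ci, !Cmod_R. lra.
  - destruct c as [x y]. unfold Cplus, Cmult, RtoC, Ci; simpl. f_equal; ring.
Qed.

Lemma summable_le (a : nat -> C) (B : nat -> R) :
  (forall n, Cmod (a n) <= B n) -> ex_series B -> summable a.
Proof.
  intros Hle HB.
  apply (ex_series_le (V := R_CompleteNormedModule) _ B); [|exact HB].
  intro n. change norm with Rabs. simpl.
  rewrite Rabs_pos_eq by apply Cmod_ge_0. apply Hle.
Qed.

Lemma summable_Re (a : nat -> C) : summable a -> ex_series (fun n => Re (a n)).
Proof.
  intro H. apply (Series_abs_le _ _ (fun n => re_le_Cmod (a n)) H).
Qed.

Lemma summable_Im (a : nat -> C) : summable a -> ex_series (fun n => Im (a n)).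
Proof.
  intro H. apply (Series_abs_le _ _ (fun n => Im_le_Cmod (a n)) H).
Qed.

Lemma CSeries_ext (a b : nat -> C) :
  (forall n, a n = b n) -> CSeries a = CSeries b.
Proof.
  intro H. unfold CSeries.
  f_equal; apply Series_ext; intro n; now rewrite H.
Qed.

Lemma Cmod_CSeries_le (a : nat -> C) (B : nat -> R) :
  (forall n, Cmod (a n) <= B n) -> ex_series B ->
  Cmod (CSeries a) <= 2 * Series B.
Proof.
  intros Hle HB. eapply Rle_trans; [apply Cmod_le_sum|].
  assert (Rabs (Series (fun n => Re (a n))) <= Series B).
  { apply Series_abs_le; [|exact HB]. intro n.
    eapply Rle_trans; [apply re_le_Cmod|apply Hle]. }
  assert (Rabs (Series (fun n => Im (a n))) <= Series B).
  { apply Series_abs_le; [|exact HB]. intro n.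
    eapply Rle_trans; [apply Im_le_Cmod|apply Hle]. }
  unfold CSeries; simpl Re; simpl Im. lra.
Qed.

Lemma CSeries_plus (a b : nat -> C) : summable a -> summable b ->
  CSeries (fun n => Cplus (a n) (b n)) = Cplus (CSeries a) (CSeries b).
Proof.
  intros Ha Hb. unfold CSeries, Cplus; simpl. f_equal.
  - apply (Series_plus (fun n => Re (a n)) (fun n => Re (b n)));
      now apply summable_Re.
  - apply (Series_plus (fun n => Im (a n)) (fun n => Im (b n)));
      now apply summable_Im.
Qed.

Lemma CSeries_scal (c : C) (a : nat -> C) : summable a ->
  CSeries (fun n => Cmult c (a n)) = Cmult c (CSeries a).
Proof.
  intro Ha.
  assert (HR := summable_Re a Ha). assert (HI := summable_Im a Ha).
  destruct c as [x y]. unfold CSeries, Cmult; simpl. f_equal.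
  - rewrite <- !Series_scal_l.
    apply (Series_minus (fun n => x * Re (a n)) (fun n => y * Im (a n)));
      now apply (ex_series_scal_l (V := R_NormedModule)).
  - rewrite <- !Series_scal_l.
    apply (Series_plus (fun n => x * Im (a n)) (fun n => y * Re (a n)));
      now apply (ex_series_scal_l (V := R_NormedModule)).
Qed.

(** This is how the entries off the diagonal of [K] get their closed form. *)
Lemma CSeries_telescoping (D : nat -> C) :
  is_lim_seq (fun n => Cmod (D n)) 0 ->
  CSeries (fun n => Cminus (D n) (D (S n))) = D 0%nat.
Proof.
  intro HD.
  assert (Hcomp : forall f : nat -> R,
            (forall n, Rabs (f n) <= Cmod (D n)) -> is_lim_seq f 0).
  { intros f Hf. apply is_lim_seq_abs_0.
    apply is_lim_seq_le_le with (fun _ => 0) (fun n => Cmod (D n)).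
    - intro n. split; [apply Rabs_pos|apply Hf].
    - apply is_lim_seq_const.
    - exact HD. }
  rewrite (surjective_pairing (D 0%nat)). unfold CSeries. f_equal.
  - apply is_series_unique.
    apply (is_series_telescoping (fun n => Re (D n))), Hcomp.
    intro n. apply re_le_Cmod.
  - apply is_series_unique.
    apply (is_series_telescoping (fun n => Im (D n))), Hcomp.
    intro n. apply Im_le_Cmod.
Qed.

Lemma CSeries_basis_vector (a : nat -> C) (k : nat) :
  CSeries (fun n => Cmult (a n) (basis_vector k n)) = a k.
Proof.
  assert (Hk : Cmult (a k) (basis_vector k k) = a k).
  { unfold basis_vector. rewrite Nat.eqb_refl. apply Cmult_1_r. }
  assert (Hn : forall n, n <> k -> Cmult (a n) (basis_vector k n) = RtoC 0).
  { intros n Hn. unfold basis_vector.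
    apply Nat.eqb_neq in Hn. rewrite Hn. apply Cmult_0_r. }
  rewrite <- Hk. rewrite (surjective_pairing (Cmult (a k) _)).
  unfold CSeries. f_equal; apply is_series_unique.
  - apply (Series_single (fun n => Re (Cmult (a n) (basis_vector k n)))).
    intros n Hne. now rewrite Hn.
  - apply (Series_single (fun n => Im (Cmult (a n) (basis_vector k n)))).
    intros n Hne. now rewrite Hn.
Qed.

Lemma CSeries_RtoC (f : nat -> R) :
  CSeries (fun n => RtoC (f n)) = RtoC (Series f).
Proof.
  unfold CSeries, RtoC; simpl. f_equal. apply Series_zero. reflexivity.
Qed.

(** * A trace class criterion *)

Lemma term_le_Series (f : nat -> R) (k : nat) :
  (forall n, 0 <= f n) -> ex_series f -> f k <= Series f.
Proof.
  intros Hpos Hf. set (g := fun n => if Nat.eqb n k then f n else 0).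
  assert (Hgk : g k = f k) by (unfold g; now rewrite Nat.eqb_refl).
  rewrite <- Hgk, <- (is_series_unique _ _ (Series_single g k
    ltac:(intros n Hn; unfold g; apply Nat.eqb_neq in Hn; now rewrite Hn))).
  apply Series_le; [|exact Hf].
  intro n. unfold g. pose proof (Hpos n). destruct (Nat.eqb n k); lra.
Qed.

Lemma l2_norm_pos (x : nat -> C) : 0 <= l2_norm x.
Proof. apply sqrt_pos. Qed.

Lemma Cmod_le_l2_norm (x : nat -> C) (k : nat) :
  in_l2 x -> Cmod (x k) <= l2_norm x.
Proof.
  intro Hx. rewrite <- (sqrt_pow2 (Cmod (x k))) by apply Cmod_ge_0.
  apply sqrt_le_1_alt.
  apply (term_le_Series (fun n => Cmod (x n) ^ 2)); [|exact Hx].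
  intro n. apply pow2_ge_0.
Qed.

(** Outputs are estimated coordinatewise; this turns such an estimate into an
    operator norm estimate. *)
Lemma l2_of_decay (y : nat -> C) (B : R) :
  0 <= B -> (forall j, Cmod (y j) <= B / (INR j + 1)) ->
  in_l2 y /\ l2_norm y <= B * sqrt inv_square_sum.
Proof.
  intros HB Hy.
  assert (Hle : forall j, Cmod (y j) ^ 2 <= B ^ 2 * / (INR j + 1) ^ 2).
  { intro j. rewrite <- pow_inv, <- Rpow_mult_distr. apply pow_incr.
    split; [apply Cmod_ge_0|apply Hy]. }
  assert (Hex : ex_series (fun j => B ^ 2 * / (INR j + 1) ^ 2)).
  { apply (ex_series_scal_l (V := R_NormedModule) (B ^ 2)
             (fun j => / (INR j + 1) ^ 2)), ex_series_inv_square. }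
  split.
  - apply (ex_series_le (V := R_CompleteNormedModule) _
             (fun j => B ^ 2 * / (INR j + 1) ^ 2)); [|exact Hex].
    intro j. change norm with Rabs. simpl Rabs.
    rewrite Rabs_pos_eq by apply pow2_ge_0. apply Hle.
  - unfold l2_norm. rewrite <- (sqrt_pow2 B HB) at 1.
    rewrite <- sqrt_mult_alt by apply pow2_ge_0.
    apply sqrt_le_1_alt. unfold inv_square_sum. rewrite <- Series_scal_l.
    apply Series_le; [|exact Hex].
    intro j. split; [apply pow2_ge_0|apply Hle].
Qed.

Lemma in_l2_basis_vector (k : nat) : in_l2 (basis_vector k).
Proof.
  eexists. apply (Series_single (fun n => Cmod (basis_vector k n) ^ 2) k).
  intros n Hn. unfold basis_vector. apply Nat.eqb_neq in Hn. rewrite Hn, Cmod_0.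
  ring.
Qed.

(** The supremum may be infinite, in which case its real part is 0 by
    convention; otherwise the zero vector supplies a nonnegative value. *)
Lemma op_norm_ge_0 (T : operator) : 0 <= op_norm T.
Proof.
  unfold op_norm.
  set (E := fun r => _).
  destruct (Lub_Rbar_correct E) as [Hub _].
  destruct (Lub_Rbar E) as [l| |]; simpl; try lra.
  assert (Hz : is_series (fun _ : nat => Cmod (RtoC 0) ^ 2) (Cmod (RtoC 0) ^ 2)).
  { apply (Series_single (fun _ => Cmod (RtoC 0) ^ 2) 0%nat).
    intros n _. rewrite Cmod_0. ring. }
  assert (HE : E (l2_norm (T (fun _ => RtoC 0)))).
  { exists (fun _ => RtoC 0). split; [eexists; apply Hz|]. split; [|reflexivity].
    unfold l2_norm. rewrite (is_series_unique _ _ Hz), Cmod_0.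
    replace (0 ^ 2) with 0 by ring. rewrite sqrt_0. lra. }
  pose proof (l2_norm_pos (T (fun _ => RtoC 0))).
  specialize (Hub _ HE). simpl in Hub. lra.
Qed.

Lemma op_norm_le (T : operator) (r : R) : 0 <= r ->
  (forall x, in_l2 x -> l2_norm x <= 1 -> l2_norm (T x) <= r) -> op_norm T <= r.
Proof.
  intros Hr HT. unfold op_norm.
  set (E := fun r => _).
  destruct (Lub_Rbar_correct E) as [_ Hlub].
  assert (H : Rbar_le (Lub_Rbar E) r).
  { apply Hlub. intros s (x & Hx & Hx1 & ->). now apply HT. }
  destruct (Lub_Rbar E); simpl in *; try lra; contradiction.
Qed.

(** Zero is a lower bound of all the distances, so that the infimum is finite and
    bounded by any one of them. *)
Lemma singular_number_bounds (T F : operator) (n : nat) :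
  bounded_operator F -> rank_le n F ->
  0 <= singular_number T n <= op_norm (op_sub T F).
Proof.
  intros HF Hrk. unfold singular_number.
  set (E := fun r => _).
  destruct (Glb_Rbar_correct E) as [Hlb Hglb].
  assert (H0 : Rbar_le 0 (Glb_Rbar E)).
  { apply Hglb. intros r (G & _ & _ & ->). apply op_norm_ge_0. }
  specialize (Hlb (op_norm (op_sub T F)) (ex_intro _ F (conj HF (conj Hrk eq_refl)))).
  destruct (Glb_Rbar E); simpl in *; try lra; contradiction.
Qed.

Definition linear_on_l2 (T : operator) : Prop :=
  forall (c : C) (x y : nat -> C), in_l2 x -> in_l2 y ->
  forall n, T (fun m => Cplus (Cmult c (x m)) (y m)) n
            = Cplus (Cmult c (T x n)) (T y n).

Definition truncation (n : nat) (T : operator) : operator :=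
  fun x j => if Nat.ltb j n then T x j else RtoC 0.

Lemma truncation_rank (n : nat) (T : operator) : rank_le n (truncation n T).
Proof.
  exists (fun i => basis_vector (i - 1)). split; [intro; apply in_l2_basis_vector|].
  intros x _. exists (fun i => T x (i - 1)%nat). intro j.
  assert (Hind : forall m,
    sum_n_m (fun i => Cmult (T x (i - 1)%nat) (basis_vector (i - 1) j)) 1 m
    = if Nat.ltb j m then T x j else RtoC 0).
  { induction m as [|m IH].
    - rewrite sum_n_m_zero by lia. reflexivity.
    - rewrite sum_n_Sm by lia. rewrite IH.
      replace (S m - 1)%nat with m by lia. change plus with Cplus.
      unfold basis_vector.
      destruct (Nat.ltb_spec j m); destruct (Nat.ltb_spec j (S m));
        destruct (Nat.eqb_spec j m); try lia; subst;
        rewrite ?Cmult_0_r, ?Cmult_1_r, ?Cplus_0_r, ?Cplus_0_l; reflexivity. }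
  symmetry. apply Hind.
Qed.

(** An operator that sends a vector of norm 1 to coordinates of size [j^-3] is
    well approximated by its truncations: dropping the coordinates from [n] on
    leaves an error of order [n^-2] in operator norm. Thus the singular numbers
    are summable. *)
Section Smoothing.

Variables (T : operator) (A : R).
Hypothesis A_pos : 0 <= A.
Hypothesis T_linear : linear_on_l2 T.
Hypothesis T_decay : forall x, in_l2 x -> forall j,
  Cmod (T x j) <= A * l2_norm x / (INR j + 1) ^ 3.

Lemma norm_scaled_pos (x : nat -> C) : 0 <= A * l2_norm x.
Proof. apply Rmult_le_pos; [exact A_pos|apply l2_norm_pos]. Qed.

(** Two of the three powers of [1/(j+1)] pay for the gain in [n]; the one left
    keeps the coordinates square summable. *)
Lemma decay_past (x : nat -> C) (n j : nat) : in_l2 x -> (n <= j)%nat ->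
  Cmod (T x j) <= A * l2_norm x / (INR n + 1) ^ 2 / (INR j + 1).
Proof.
  intros Hx Hnj. eapply Rle_trans; [now apply T_decay|].
  unfold Rdiv. rewrite (Rmult_assoc (A * l2_norm x)).
  apply Rmult_le_compat_l; [apply norm_scaled_pos|].
  apply le_INR in Hnj. pose proof (pos_INR n).
  rewrite <- Rinv_mult. apply Rinv_le_contravar.
  - apply Rmult_lt_0_compat; [apply pow_lt|]; lra.
  - replace ((INR j + 1) ^ 3) with ((INR j + 1) ^ 2 * (INR j + 1)) by ring.
    apply Rmult_le_compat_r; [lra|]. apply pow_incr; lra.
Qed.

Lemma decay_simple (x : nat -> C) (j : nat) : in_l2 x ->
  Cmod (T x j) <= A * l2_norm x / (INR j + 1).
Proof.
  intro Hx. pose proof (decay_past x 0 j Hx (Nat.le_0_l j)) as H.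
  simpl INR in H. replace ((0 + 1) ^ 2) with 1 in H by ring.
  now rewrite Rdiv_1_r in H.
Qed.

Lemma smoothing_bounded : bounded_operator T.
Proof.
  split; [exact T_linear|].
  exists (A * sqrt inv_square_sum). intros x Hx.
  destruct (l2_of_decay (T x) (A * l2_norm x) (norm_scaled_pos x)) as [H1 H2].
  { intro j. now apply decay_simple. }
  split; [exact H1|]. lra.
Qed.

Lemma truncation_bounded (n : nat) : bounded_operator (truncation n T).
Proof.
  split.
  - intros c x y Hx Hy j. unfold truncation. destruct (Nat.ltb j n).
    + now apply T_linear.
    + rewrite Cmult_0_r, Cplus_0_r. reflexivity.
  - exists (A * sqrt inv_square_sum). intros x Hx.
    destruct (l2_of_decay (truncation n T x) (A * l2_norm x) (norm_scaled_pos x))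
      as [H1 H2].
    { intro j. unfold truncation. destruct (Nat.ltb j n); [now apply decay_simple|].
      rewrite Cmod_0. apply Rdiv_le_0_compat; [apply norm_scaled_pos|apply INR1_pos]. }
    split; [exact H1|]. lra.
Qed.

Lemma truncation_error (n : nat) :
  op_norm (op_sub T (truncation n T))
  <= A * sqrt inv_square_sum * / (INR n + 1) ^ 2.
Proof.
  assert (Hn : 0 < (INR n + 1) ^ 2) by (apply pow_lt, INR1_pos).
  assert (HS : 0 <= sqrt inv_square_sum) by apply sqrt_pos.
  assert (Hin : 0 <= / (INR n + 1) ^ 2) by (left; now apply Rinv_0_lt_compat).
  apply op_norm_le.
  { apply Rmult_le_pos; [|exact Hin]. now apply Rmult_le_pos. }
  intros x Hx Hx1.
  assert (HB : 0 <= A * l2_norm x / (INR n + 1) ^ 2).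
  { apply Rdiv_le_0_compat; [apply norm_scaled_pos|exact Hn]. }
  destruct (l2_of_decay (op_sub T (truncation n T) x) _ HB) as [_ H].
  { intro j. unfold op_sub, truncation. destruct (Nat.ltb_spec j n) as [Hj|Hj].
    - replace (Cminus (T x j) (T x j)) with (RtoC 0)
        by (unfold Cminus; now rewrite Cplus_opp_r).
      rewrite Cmod_0. apply Rdiv_le_0_compat; [exact HB|apply INR1_pos].
    - replace (Cminus (T x j) (RtoC 0)) with (T x j); [now apply decay_past|].
      unfold Cminus. rewrite Copp_0. now rewrite Cplus_0_r. }
  eapply Rle_trans; [exact H|].
  replace (A * l2_norm x / (INR n + 1) ^ 2 * sqrt inv_square_sum)
    with (A * sqrt inv_square_sum * / (INR n + 1) ^ 2 * l2_norm x)
    by (unfold Rdiv; ring).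
  rewrite <- (Rmult_1_r (A * sqrt inv_square_sum * _)) at 2.
  apply Rmult_le_compat_l; [|exact Hx1].
  apply Rmult_le_pos; [now apply Rmult_le_pos|exact Hin].
Qed.

Lemma smoothing_trace_class : trace_class T.
Proof.
  split; [apply smoothing_bounded|].
  apply (ex_series_le (V := R_CompleteNormedModule) _
           (fun n => A * sqrt inv_square_sum * / (INR n + 1) ^ 2)).
  - intro n. change norm with Rabs. simpl Rabs.
    destruct (singular_number_bounds T _ n (truncation_bounded n)
                (truncation_rank n T)) as [H1 H2].
    rewrite Rabs_pos_eq by exact H1.
    eapply Rle_trans; [exact H2|apply truncation_error].
  - apply (ex_series_scal_l (V := R_NormedModule) (A * sqrt inv_square_sum)
             (fun n => / (INR n + 1) ^ 2)), ex_series_inv_square.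
Qed.

End Smoothing.

(** * Hankel operators with rapidly decreasing symbol *)

(** Only nonnegative indices are constrained, since a Hankel matrix reads its
    symbol at positive indices. *)
Definition decays (p : nat) (a : Z -> C) : Prop :=
  exists A, 0 <= A /\ forall n : nat, Cmod (a (Z.of_nat n)) <= A / (INR n + 1) ^ p.

Lemma hankel_index (j k : nat) : (idx j + idx k - 1)%Z = Z.of_nat (S (j + k)).
Proof. unfold idx. lia. Qed.

Lemma hankel_term_bound (a : Z -> C) (A M : R) (x : nat -> C) (j k : nat) :
  0 <= A -> (forall n : nat, Cmod (a (Z.of_nat n)) <= A / (INR n + 1) ^ 5) ->
  (forall k, Cmod (x k) <= M) ->
  Cmod (Cmult (a (idx j + idx k - 1)%Z) (x k))
  <= A * M / (INR j + 1) ^ 3 * / (INR k + 1) ^ 2.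
Proof.
  intros HA Ha Hx. rewrite Cmod_mult, hankel_index.
  pose proof (pos_INR (j + k)).
  replace (A * M / (INR j + 1) ^ 3 * / (INR k + 1) ^ 2)
    with (A * (/ (INR j + 1) ^ 3 * / (INR k + 1) ^ 2) * M) by (unfold Rdiv; ring).
  apply Rmult_le_compat; try apply Cmod_ge_0; [|apply Hx].
  eapply Rle_trans; [apply Ha|]. unfold Rdiv.
  apply Rmult_le_compat_l; [exact HA|].
  rewrite S_INR. replace (INR (j + k) + 1 + 1) with (INR (j + k) + 2) by ring.
  apply inv_pow5_split.
Qed.

Lemma ex_series_hankel_bound (c : R) :
  ex_series (fun k => c * / (INR k + 1) ^ 2).
Proof.
  apply (ex_series_scal_l (V := R_NormedModule) c (fun k => / (INR k + 1) ^ 2)),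
    ex_series_inv_square.
Qed.

Lemma hankel_summable (a : Z -> C) (M : R) (x : nat -> C) (j : nat) :
  decays 5 a -> (forall k, Cmod (x k) <= M) ->
  summable (fun k => Cmult (a (idx j + idx k - 1)%Z) (x k)).
Proof.
  intros (A & HA & Ha) Hx.
  apply (summable_le _ (fun k => A * M / (INR j + 1) ^ 3 * / (INR k + 1) ^ 2)).
  - intro k. now apply hankel_term_bound.
  - apply ex_series_hankel_bound.
Qed.

(** A sup norm bound on the input is enough, which makes compositions easy to
    estimate: bounded input gives cubic decay, hence bounded output again. *)
Lemma hankel_bound (a : Z -> C) : decays 5 a ->
  exists B, 0 <= B /\ forall (M : R) (x : nat -> C),
    (forall k, Cmod (x k) <= M) ->
    forall j, Cmod (hankel a x j) <= B * M / (INR j + 1) ^ 3.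
Proof.
  intros (A & HA & Ha). exists (2 * A * inv_square_sum). split.
  { apply Rmult_le_pos; [lra|apply inv_square_sum_pos]. }
  intros M x Hx j.
  replace (2 * A * inv_square_sum * M / (INR j + 1) ^ 3)
    with (2 * Series (fun k => A * M / (INR j + 1) ^ 3 * / (INR k + 1) ^ 2)).
  - apply Cmod_CSeries_le; [|apply ex_series_hankel_bound].
    intro k. now apply hankel_term_bound.
  - rewrite Series_scal_l. unfold inv_square_sum, Rdiv. ring.
Qed.

Lemma hankel_linear (a : Z -> C) (c : C) (M N : R) (x y : nat -> C) (j : nat) :
  decays 5 a -> (forall k, Cmod (x k) <= M) -> (forall k, Cmod (y k) <= N) ->
  hankel a (fun m => Cplus (Cmult c (x m)) (y m)) j
  = Cplus (Cmult c (hankel a x j)) (hankel a y j).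
Proof.
  intros Ha Hx Hy. unfold hankel.
  assert (Hcx : forall k, Cmod (Cmult c (x k)) <= Cmod c * M).
  { intro k. rewrite Cmod_mult. apply Rmult_le_compat_l; [apply Cmod_ge_0|apply Hx]. }
  rewrite <- CSeries_scal by (eapply hankel_summable; eassumption).
  rewrite <- CSeries_plus.
  - apply CSeries_ext. intro k. ring.
  - apply (summable_le _ (fun k =>
      Cmod (Cmult (a (idx j + idx k - 1)%Z) (Cmult c (x k))))).
    + intro k. right. f_equal. ring.
    + apply (hankel_summable a (Cmod c * M) (fun k => Cmult c (x k)) j Ha Hcx).
  - eapply hankel_summable; eassumption.
Qed.

Lemma hankel_bounded_output (a : Z -> C) (B M : R) (x : nat -> C) :
  0 <= B -> (forall k, Cmod (x k) <= M) ->
  (forall j, Cmod (hankel a x j) <= B * M / (INR j + 1) ^ 3) ->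
  forall j, Cmod (hankel a x j) <= B * M.
Proof.
  intros HB Hx H j. eapply Rle_trans; [apply H|].
  assert (HM : 0 <= B * M).
  { apply Rmult_le_pos; [exact HB|].
    eapply Rle_trans; [apply Cmod_ge_0|apply (Hx 0%nat)]. }
  apply Rle_div_l; [apply pow_lt, INR1_pos|].
  rewrite <- (Rmult_1_r (B * M)) at 1. apply Rmult_le_compat_l; [exact HM|].
  apply pow_R1_Rle. pose proof (pos_INR j); lra.
Qed.

Lemma hankel_comp_linear (a b : Z -> C) (c : C) (M N : R) (x y : nat -> C) (j : nat) :
  decays 5 a -> decays 5 b ->
  (forall k, Cmod (x k) <= M) -> (forall k, Cmod (y k) <= N) ->
  hankel a (hankel b (fun m => Cplus (Cmult c (x m)) (y m))) j
  = Cplus (Cmult c (hankel a (hankel b x) j)) (hankel a (hankel b y) j).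
Proof.
  intros Ha Hb Hx Hy.
  destruct (hankel_bound b Hb) as (B & HB & HBb).
  rewrite <- (hankel_linear a c (B * M) (B * N) (hankel b x) (hankel b y) j Ha).
  - apply CSeries_ext. intro k. f_equal. now apply hankel_linear with M N.
  - apply hankel_bounded_output; auto.
  - apply hankel_bounded_output; auto.
Qed.

Lemma hankel_comp_bound (a b : Z -> C) : decays 5 a -> decays 5 b ->
  exists B, 0 <= B /\ forall (M : R) (x : nat -> C),
    (forall k, Cmod (x k) <= M) ->
    forall j, Cmod (hankel a (hankel b x) j) <= B * M / (INR j + 1) ^ 3.
Proof.
  intros Ha Hb.
  destruct (hankel_bound a Ha) as (A & HA & HAa).
  destruct (hankel_bound b Hb) as (B & HB & HBb).
  exists (A * B). split; [now apply Rmult_le_pos|].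
  intros M x Hx j. rewrite Rmult_assoc. apply HAa.
  apply hankel_bounded_output; auto.
Qed.

Definition times_index (b : Z -> C) : Z -> C :=
  fun n => Cmult (RtoC (IZR n)) (b n).

Lemma decays_times_index (p : nat) (b : Z -> C) :
  decays (S p) b -> decays p (times_index b).
Proof.
  intros (A & HA & H). exists A. split; [exact HA|]. intro n.
  unfold times_index. rewrite Cmod_mult, Cmod_R, <- INR_IZR_INZ.
  pose proof (pos_INR n).
  rewrite Rabs_pos_eq by lra.
  apply Rle_trans with ((INR n + 1) * (A / (INR n + 1) ^ S p)).
  - apply Rmult_le_compat; try lra; [apply Cmod_ge_0|apply H].
  - right. simpl. field. split; [apply pow_nonzero|]; lra.
Qed.

Lemma decays_le (p : nat) (b : Z -> C) : decays (S p) b -> decays p b.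
Proof.
  intros (A & HA & H). exists A. split; [exact HA|]. intro n.
  eapply Rle_trans; [apply H|]. unfold Rdiv.
  apply Rmult_le_compat_l; [exact HA|].
  pose proof (pos_INR n).
  apply Rinv_le_contravar; [apply pow_lt; lra|].
  apply Rle_pow; [lra|lia].
Qed.

Lemma mathieu_K_trace_class (beta : R) (b : Z -> C) :
  decays 6 b -> trace_class (mathieu_K beta b).
Proof.
  intro Hb6.
  assert (Hb : decays 5 b) by now apply decays_le.
  assert (Hv : decays 5 (times_index b)) by now apply decays_times_index.
  destruct (hankel_comp_bound _ _ Hb Hv) as (B1 & HB1 & H1).
  destruct (hankel_comp_bound _ _ Hv Hb) as (B2 & HB2 & H2).
  apply smoothing_trace_class with (Cmod (RtoC (2 / beta)) * (B1 + B2)).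
  - apply Rmult_le_pos; [apply Cmod_ge_0|lra].
  - intros c x y Hx Hy j. unfold mathieu_K. cbv zeta.
    fold (times_index b).
    assert (Hx' := fun k => Cmod_le_l2_norm x k Hx).
    assert (Hy' := fun k => Cmod_le_l2_norm y k Hy).
    rewrite (hankel_comp_linear _ _ c _ _ x y j Hb Hv Hx' Hy').
    rewrite (hankel_comp_linear _ _ c _ _ x y j Hv Hb Hx' Hy').
    ring.
  - intros x Hx j. unfold mathieu_K. cbv zeta. fold (times_index b).
    assert (Hx' := fun k => Cmod_le_l2_norm x k Hx).
    rewrite Cmod_mult.
    replace (Cmod (RtoC (2 / beta)) * (B1 + B2) * l2_norm x / (INR j + 1) ^ 3)
      with (Cmod (RtoC (2 / beta)) * (B1 * l2_norm x / (INR j + 1) ^ 3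
                                      + B2 * l2_norm x / (INR j + 1) ^ 3))
      by (unfold Rdiv; ring).
    apply Rmult_le_compat_l; [apply Cmod_ge_0|].
    eapply Rle_trans; [apply Cmod_triangle|].
    apply Rplus_le_compat; [now apply H1|now apply H2].
Qed.

(** * The three-term recurrence *)

Definition mathieu_recurrence (alpha beta : R) (b : Z -> C) : Prop :=
  forall n : Z,
    Cmult (RtoC (IZR n ^ 2)) (b n)
    = Cplus (Cmult (RtoC alpha) (b n))
            (Cmult (RtoC (beta / 2)) (Cplus (b (n - 1)%Z) (b (n + 1)%Z))).

(** The recurrence bounds [n^2 |b_n|] by the neighbouring coefficients, so any
    decay improves by two powers of [n]. In the constant, [2^(p+2)] comes from
    comparing [n + 1] with [2 n] for [n >= 1], and the summand [A] covers [n = 0]. *)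
Lemma recurrence_decay_step (alpha beta : R) (b : Z -> C) (p : nat) :
  mathieu_recurrence alpha beta b -> decays p b -> decays (p + 2) b.
Proof.
  intros Hrec (A & HA & H).
  exists (A + 2 ^ (p + 2) * ((Rabs alpha + Rabs beta) * A)).
  pose proof (Rabs_pos alpha) as Hal. pose proof (Rabs_pos beta) as Hbe.
  assert (Hc : 0 <= (Rabs alpha + Rabs beta) * A) by (apply Rmult_le_pos; lra).
  assert (H2 : 0 < 2 ^ (p + 2)) by (apply pow_lt; lra).
  assert (HcA : 0 <= 2 ^ (p + 2) * ((Rabs alpha + Rabs beta) * A))
    by (apply Rmult_le_pos; lra).
  split; [lra|]. intro n.
  destruct n as [|n].
  { specialize (H 0%nat). simpl INR in *.
    replace (0 + 1) with 1 in * by ring. rewrite pow1 in *.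
    unfold Rdiv in *. rewrite Rinv_1, Rmult_1_r in *. lra. }
  pose proof (pos_INR n) as Hn. rewrite S_INR. set (s := INR n + 1).
  assert (Hs : 1 <= s) by (unfold s; lra).
  assert (Hsp : 0 < s ^ p) by (apply pow_lt; lra).
  assert (Hsp2 : 0 < s ^ 2) by (apply pow_lt; lra).
  assert (Hnear : forall m : nat, (n <= m)%nat -> Cmod (b (Z.of_nat m)) <= A / s ^ p).
  { intros m Hm. eapply Rle_trans; [apply H|]. unfold Rdiv.
    apply Rmult_le_compat_l; [exact HA|]. apply Rinv_le_contravar; [exact Hsp|].
    apply le_INR in Hm. apply pow_incr. unfold s; lra. }
  assert (Hmul : s ^ 2 * Cmod (b (Z.of_nat (S n)))
                 <= (Rabs alpha + Rabs beta) * (A / s ^ p)).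
  { specialize (Hrec (Z.of_nat (S n))).
    apply (f_equal Cmod) in Hrec.
    rewrite Cmod_mult, Cmod_R, <- INR_IZR_INZ, S_INR in Hrec. fold s in Hrec.
    rewrite Rabs_pos_eq in Hrec by lra. rewrite Hrec.
    eapply Rle_trans; [apply Cmod_triangle|].
    rewrite !Cmod_mult, !Cmod_R.
    replace (Z.of_nat (S n) - 1)%Z with (Z.of_nat n) by lia.
    replace (Z.of_nat (S n) + 1)%Z with (Z.of_nat (S (S n))) by lia.
    assert (Ht := Cmod_triangle (b (Z.of_nat n)) (b (Z.of_nat (S (S n))))).
    assert (H0 := Hnear n ltac:(lia)). assert (H1 := Hnear (S n) ltac:(lia)).
    assert (H3 := Hnear (S (S n)) ltac:(lia)).
    rewrite Rmult_plus_distr_r. apply Rplus_le_compat.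
    - apply Rmult_le_compat_l; [apply Rabs_pos|exact H1].
    - unfold Rdiv at 1. rewrite Rabs_mult, (Rabs_pos_eq (/ 2)) by lra.
      rewrite Rmult_assoc. apply Rmult_le_compat_l; [apply Rabs_pos|]. lra. }
  assert (Hx : Cmod (b (Z.of_nat (S n))) <= (Rabs alpha + Rabs beta) * A / s ^ (p + 2)).
  { apply Rmult_le_reg_l with (s ^ 2); [exact Hsp2|].
    eapply Rle_trans; [exact Hmul|]. right.
    rewrite pow_add. field. split; [lra|apply pow_nonzero; lra]. }
  eapply Rle_trans; [exact Hx|].
  apply Rle_trans with (2 ^ (p + 2) * ((Rabs alpha + Rabs beta) * A) / (s + 1) ^ (p + 2)).
  - assert (Hs1 : 0 < (s + 1) ^ (p + 2)) by (apply pow_lt; lra).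
    apply Rle_div_l; [apply pow_lt; lra|].
    replace (2 ^ (p + 2) * ((Rabs alpha + Rabs beta) * A) / (s + 1) ^ (p + 2) * s ^ (p + 2))
      with ((Rabs alpha + Rabs beta) * A * ((2 * s) ^ (p + 2) / (s + 1) ^ (p + 2)))
      by (rewrite Rpow_mult_distr; unfold Rdiv; ring).
    rewrite <- (Rmult_1_r ((Rabs alpha + Rabs beta) * A)) at 1.
    apply Rmult_le_compat_l; [exact Hc|].
    apply Rle_div_r; [exact Hs1|]. rewrite Rmult_1_l. apply pow_incr; lra.
  - unfold Rdiv. apply Rmult_le_compat_r; [|lra].
    left. apply Rinv_0_lt_compat, pow_lt; lra.
Qed.

Lemma recurrence_decays_6 (alpha beta M : R) (b : Z -> C) :
  mathieu_recurrence alpha beta b ->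
  (forall n, Cmod (b n) <= M) -> decays 6 b.
Proof.
  intros Hrec HM.
  apply (recurrence_decay_step alpha beta b 4 Hrec).
  apply (recurrence_decay_step alpha beta b 2 Hrec).
  apply (recurrence_decay_step alpha beta b 0 Hrec).
  exists M. split.
  - eapply Rle_trans; [apply Cmod_ge_0|apply (HM 0%Z)].
  - intro n. rewrite Rdiv_1_r. apply HM.
Qed.

(** * Matrix entries *)

Lemma hankel_basis_vector (a : Z -> C) (j k : nat) :
  hankel a (basis_vector k) j = a (idx j + idx k - 1)%Z.
Proof.
  exact (CSeries_basis_vector (fun k => a (idx j + idx k - 1)%Z) k).
Qed.

Lemma decays_sup (p : nat) (b : Z -> C) : decays p b ->
  exists M, 0 <= M /\ forall n : nat, Cmod (b (Z.of_nat n)) <= M.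
Proof.
  intros (A & HA & H). exists A. split; [exact HA|]. intro n.
  eapply Rle_trans; [apply H|]. pose proof (pos_INR n).
  apply Rle_div_l; [apply pow_lt; lra|].
  rewrite <- (Rmult_1_r A) at 1. apply Rmult_le_compat_l; [exact HA|].
  apply pow_R1_Rle; lra.
Qed.

Lemma hankel_comp_entry (a b : Z -> C) (j k : nat) :
  hankel a (hankel b (basis_vector k)) j
  = CSeries (fun m => Cmult (a (idx j + idx m - 1)%Z) (b (idx k + idx m - 1)%Z)).
Proof.
  unfold hankel at 1. apply CSeries_ext. intro m.
  rewrite hankel_basis_vector. now rewrite (Z.add_comm (idx m)).
Qed.

Lemma hankel_comp_summable (a b : Z -> C) (j k : nat) :
  decays 5 a -> decays 5 b ->
  summable (fun m => Cmult (a (idx j + idx m - 1)%Z) (b (idx k + idx m - 1)%Z)).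
Proof.
  intros Ha Hb. destruct (decays_sup 5 b Hb) as (M & _ & HM).
  apply (hankel_summable a M (fun m => b (idx k + idx m - 1)%Z) j Ha).
  intro m. rewrite hankel_index. apply HM.
Qed.

(** Adding the products in both orders turns the weight of [Gamma_v] into the
    symmetric factor [J + K + 2m], the one that telescopes below. *)
Lemma symmetrized_term (b : Z -> C) (j k m : nat) :
  Cplus (Cmult (b (idx j + idx m - 1)%Z) (times_index b (idx k + idx m - 1)%Z))
        (Cmult (times_index b (idx j + idx m - 1)%Z) (b (idx k + idx m - 1)%Z))
  = Cmult (RtoC (IZR (idx j + idx k + 2 * Z.of_nat m)))
      (Cmult (b (idx j + Z.of_nat m)%Z) (b (idx k + Z.of_nat m)%Z)).
Proof.
  unfold times_index.
  replace (idx j + idx m - 1)%Z with (idx j + Z.of_nat m)%Z by (unfold idx; lia).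
  replace (idx k + idx m - 1)%Z with (idx k + Z.of_nat m)%Z by (unfold idx; lia).
  replace (idx j + idx k + 2 * Z.of_nat m)%Z
    with ((idx k + Z.of_nat m) + (idx j + Z.of_nat m))%Z by ring.
  rewrite (plus_IZR (idx k + _)), RtoC_plus. ring.
Qed.

Lemma mathieu_K_entry (beta : R) (b : Z -> C) (j k : nat) : decays 6 b ->
  entry (mathieu_K beta b) j k
  = Cmult (RtoC (2 / beta)) (CSeries (fun m =>
      Cmult (RtoC (IZR (idx j + idx k + 2 * Z.of_nat m)))
        (Cmult (b (idx j + Z.of_nat m)%Z) (b (idx k + Z.of_nat m)%Z)))).
Proof.
  intro Hb6.
  assert (Hb : decays 5 b) by now apply decays_le.
  assert (Hv : decays 5 (times_index b)) by now apply decays_times_index.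
  unfold entry, mathieu_K. cbv zeta. fold (times_index b).
  rewrite !hankel_comp_entry, <- CSeries_plus by now apply hankel_comp_summable.
  f_equal. apply CSeries_ext. intro m. apply symmetrized_term.
Qed.

(** Multiply the recurrence at [p] by [b_q], the one at [q] by [b_p], and
    subtract: [alpha] cancels, and [p^2 - q^2] remains on the left. With
    [p = J + m], [q = K + m], the right side is a difference of consecutive
    values in [m] of the discrete Wronskian [b_(p-1) b_q - b_p b_(q-1)]. *)
Lemma recurrence_wronskian (alpha beta : R) (b : Z -> C) (p q : Z) :
  mathieu_recurrence alpha beta b ->
  Cmult (RtoC (IZR (p - q)))
        (Cmult (RtoC (IZR (p + q))) (Cmult (b p) (b q)))
  = Cmult (RtoC (beta / 2))
      (Cminus (Cminus (Cmult (b (p - 1)%Z) (b q)) (Cmult (b p) (b (q - 1)%Z)))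
              (Cminus (Cmult (b p) (b (q + 1)%Z)) (Cmult (b (p + 1)%Z) (b q)))).
Proof.
  intro Hrec. pose proof (Hrec p) as Hp. pose proof (Hrec q) as Hq.
  transitivity (Cminus (Cmult (Cmult (RtoC (IZR p ^ 2)) (b p)) (b q))
                       (Cmult (b p) (Cmult (RtoC (IZR q ^ 2)) (b q)))).
  - rewrite minus_IZR, plus_IZR.
    replace (IZR p ^ 2) with (IZR p * IZR p) by ring.
    replace (IZR q ^ 2) with (IZR q * IZR q) by ring.
    rewrite RtoC_minus, RtoC_plus, !RtoC_mult. ring.
  - rewrite Hp, Hq. ring.
Qed.

Lemma mathieu_K_off_diagonal (alpha beta : R) (b : Z -> C) (j k : nat) :
  beta <> 0 -> mathieu_recurrence alpha beta b -> decays 6 b -> j <> k ->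
  entry (mathieu_K beta b) j k =
  Cdiv (Cminus (Cmult (b (idx j - 1)%Z) (b (idx k)))
               (Cmult (b (idx j)) (b (idx k - 1)%Z)))
       (RtoC (IZR (idx j - idx k))).
Proof.
  intros Hbeta Hrec Hb6 Hjk.
  assert (Hb : decays 5 b) by now apply decays_le.
  assert (Hv : decays 5 (times_index b)) by now apply decays_times_index.
  assert (Hd : RtoC (IZR (idx j - idx k)) <> RtoC 0).
  { intro E. apply RtoC_inj, eq_IZR in E. unfold idx in E. lia. }
  assert (Hbc : RtoC (beta / 2) <> RtoC 0).
  { intro E. apply RtoC_inj in E. apply Hbeta. lra. }
  rewrite mathieu_K_entry by exact Hb6.
  set (S := CSeries _).
  (* The discrete Wronskian along the diagonal direction. *)
  pose (D := fun m : nat =>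
    Cminus (Cmult (b (idx j + Z.of_nat m - 1)%Z) (b (idx k + Z.of_nat m)%Z))
           (Cmult (b (idx j + Z.of_nat m)%Z) (b (idx k + Z.of_nat m - 1)%Z))).
  assert (HD : is_lim_seq (fun m => Cmod (D m)) 0).
  { destruct Hb6 as (A & HA & H).
    assert (Hone : forall n m : nat, (m <= n)%nat -> Cmod (b (Z.of_nat n)) <= A / (INR m + 1)).
    { intros n m Hnm. eapply Rle_trans; [apply H|]. unfold Rdiv.
      apply le_INR in Hnm. pose proof (pos_INR m).
      apply Rmult_le_compat_l; [exact HA|]. apply Rinv_le_contravar; [lra|].
      apply Rle_trans with (INR n + 1); [lra|].
      rewrite <- (pow_1 (INR n + 1)) at 1. apply Rle_pow; [lra|lia]. }
    destruct (decays_sup 5 b Hb) as (M & HM0 & HM).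
    apply (is_lim_seq_bounded_inv _ (2 * (A * M))). intro m.
    rewrite Rabs_pos_eq by apply Cmod_ge_0. unfold D, Cminus.
    eapply Rle_trans; [apply Cmod_triangle|]. rewrite Cmod_opp, !Cmod_mult.
    replace (idx j + Z.of_nat m - 1)%Z with (Z.of_nat (j + m)) by (unfold idx; lia).
    replace (idx k + Z.of_nat m - 1)%Z with (Z.of_nat (k + m)) by (unfold idx; lia).
    replace (idx j + Z.of_nat m)%Z with (Z.of_nat (j + m + 1)) by (unfold idx; lia).
    replace (idx k + Z.of_nat m)%Z with (Z.of_nat (k + m + 1)) by (unfold idx; lia).
    assert (H1 : Cmod (b (Z.of_nat (j + m))) * Cmod (b (Z.of_nat (k + m + 1)))
                 <= A / (INR m + 1) * M).
    { apply Rmult_le_compat; try apply Cmod_ge_0; [apply Hone; lia|apply HM]. }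
    assert (H2 : Cmod (b (Z.of_nat (j + m + 1))) * Cmod (b (Z.of_nat (k + m)))
                 <= A / (INR m + 1) * M).
    { apply Rmult_le_compat; try apply Cmod_ge_0; [apply Hone; lia|apply HM]. }
    replace (2 * (A * M) / (INR m + 1))
      with (A / (INR m + 1) * M + A / (INR m + 1) * M) by (unfold Rdiv; ring).
    lra. }
  assert (HDs : forall m,
    Cminus (D m) (D (Datatypes.S m))
    = Cmult (Cmult (/ RtoC (beta / 2))%C (RtoC (IZR (idx j - idx k))))
        (Cmult (RtoC (IZR (idx j + idx k + 2 * Z.of_nat m)))
           (Cmult (b (idx j + Z.of_nat m)%Z) (b (idx k + Z.of_nat m)%Z)))).
  { intro m.
    pose proof (recurrence_wronskian alpha beta b (idx j + Z.of_nat m)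
                  (idx k + Z.of_nat m) Hrec) as Hw.
    replace (idx j + Z.of_nat m - (idx k + Z.of_nat m))%Z
      with (idx j - idx k)%Z in Hw by ring.
    replace (idx j + Z.of_nat m + (idx k + Z.of_nat m))%Z
      with (idx j + idx k + 2 * Z.of_nat m)%Z in Hw by ring.
    rewrite <- Cmult_assoc, Hw, Cmult_assoc, Cinv_l, Cmult_1_l by exact Hbc.
    unfold D.
    replace (idx j + Z.of_nat (Datatypes.S m) - 1)%Z with (idx j + Z.of_nat m)%Z by lia.
    replace (idx k + Z.of_nat (Datatypes.S m) - 1)%Z with (idx k + Z.of_nat m)%Z by lia.
    replace (idx j + Z.of_nat (Datatypes.S m))%Z with (idx j + Z.of_nat m + 1)%Z by lia.
    replace (idx k + Z.of_nat (Datatypes.S m))%Z with (idx k + Z.of_nat m + 1)%Z by lia.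
    reflexivity. }
  assert (Hsum : summable (fun m => Cmult (RtoC (IZR (idx j + idx k + 2 * Z.of_nat m)))
           (Cmult (b (idx j + Z.of_nat m)%Z) (b (idx k + Z.of_nat m)%Z)))).
  { apply (summable_le _ (fun m =>
      Cmod (Cmult (b (idx j + idx m - 1)%Z) (times_index b (idx k + idx m - 1)%Z))
      + Cmod (Cmult (times_index b (idx j + idx m - 1)%Z) (b (idx k + idx m - 1)%Z)))).
    - intro m. rewrite <- symmetrized_term. apply Cmod_triangle.
    - apply (ex_series_plus (V := R_NormedModule)); now apply hankel_comp_summable. }
  pose proof (CSeries_telescoping D HD) as Ht.
  rewrite (CSeries_ext _ _ HDs), CSeries_scal in Ht by exact Hsum.
  fold S in Ht.
  replace (Cminus (Cmult (b (idx j - 1)%Z) (b (idx k)))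
                  (Cmult (b (idx j)) (b (idx k - 1)%Z))) with (D 0%nat)
    by (unfold D; simpl Z.of_nat; now rewrite !Z.add_0_r).
  (* [Ht] reads D 0 = (2 / beta) (J - K) S. *)
  rewrite <- Ht.
  replace (2 / beta) with (/ (beta / 2)) by (field; exact Hbeta).
  rewrite RtoC_inv by lra. field. split; assumption.
Qed.

(** * Diagonal sums *)

(** The term [a n] occurs in the tails starting at [0, ..., n]. Summation by
    parts makes this precise: the [N]-th partial sum of the tails differs from
    that of [(n+1) a_n] by [N + 1] times a tail, which vanishes in the limit. *)
Lemma is_series_tails (a : nat -> R) (A : R) : 0 <= A ->
  (forall n, Rabs (a n) <= A / (INR n + 2) ^ 5) ->
  is_series (fun j => Series (fun m => a (j + m)%nat))
            (Series (fun n => (INR n + 1) * a n)).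
Proof.
  intros HA Ha.
  pose (T := fun j => Series (fun m => a (j + m)%nat)).
  assert (HT : forall j, ex_series (fun m => a (j + m)%nat) /\
                    Rabs (T j) <= A * inv_square_sum / (INR j + 1) ^ 3).
  { intro j. apply Series_pow5_tail; [exact HA|]. intro m. apply Ha. }
  assert (Hstep : forall j, T j = a j + T (S j)).
  { intro j. unfold T. rewrite Series_incr_1 by apply HT.
    rewrite Nat.add_0_r. f_equal. apply Series_ext. intro m. f_equal. lia. }
  assert (Hsum : forall N, sum_n T N
            = sum_n (fun n => (INR n + 1) * a n) N + (INR N + 1) * T (S N)).
  { induction N as [|N IH].
    - rewrite !sum_O, (Hstep 0%nat). simpl. ring.
    - rewrite !sum_Sn, IH. change plus with Rplus. rewrite (Hstep (S N)), !S_INR.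
      simpl. ring. }
  assert (Hex : ex_series (fun n => (INR n + 1) * a n)).
  { apply (Series_abs_le _ (fun n => A * / (INR n + 1) ^ 2)).
    - intro n. pose proof (pos_INR n) as Hn. rewrite Rabs_mult, (Rabs_pos_eq (INR n + 1)) by lra.
      apply Rle_trans with ((INR n + 1) * (A / (INR n + 2) ^ 5)).
      { apply Rmult_le_compat_l; [lra|apply Ha]. }
      replace ((INR n + 1) * (A / (INR n + 2) ^ 5))
        with (A * ((INR n + 1) * / (INR n + 2) ^ 5)) by (unfold Rdiv; ring).
      apply Rmult_le_compat_l; [exact HA|].
      apply Rle_trans with ((INR n + 1) * / (INR n + 1) ^ 3).
      + apply Rmult_le_compat_l; [lra|].
        apply Rinv_le_contravar; [apply pow_lt; lra|].
        apply Rle_trans with ((INR n + 2) ^ 3); [apply pow_incr; lra|].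
        apply Rle_pow; [lra|lia].
      + right. field. lra.
    - apply ex_series_hankel_bound. }
  change (is_lim_seq (sum_n T) (Series (fun n => (INR n + 1) * a n))).
  apply (is_lim_seq_ext (fun N => sum_n (fun n => (INR n + 1) * a n) N
                                  + (INR N + 1) * T (S N))).
  { intro N. now rewrite Hsum. }
  replace (Finite (Series (fun n => (INR n + 1) * a n)))
    with (Finite (Series (fun n => (INR n + 1) * a n) + 0)) by (f_equal; ring).
  apply is_lim_seq_plus'.
  - exact (Series_correct _ Hex).
  - apply (is_lim_seq_bounded_inv _ (A * inv_square_sum)). intro N.
    pose proof (pos_INR N) as HN.
    rewrite Rabs_mult, (Rabs_pos_eq (INR N + 1)) by lra.
    apply Rle_trans with ((INR N + 1) * (A * inv_square_sum / (INR N + 1) ^ 3)).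
    + apply Rmult_le_compat_l; [lra|]. eapply Rle_trans; [apply HT|].
      unfold Rdiv. apply Rmult_le_compat_l.
      { apply Rmult_le_pos; [exact HA|apply inv_square_sum_pos]. }
      rewrite S_INR. apply Rinv_le_contravar; [apply pow_lt; lra|].
      apply pow_incr; lra.
    + replace ((INR N + 1) * (A * inv_square_sum / (INR N + 1) ^ 3))
        with (A * inv_square_sum * / (INR N + 1) ^ 2) by (field; lra).
      unfold Rdiv. apply Rmult_le_compat_l.
      { apply Rmult_le_pos; [exact HA|apply inv_square_sum_pos]. }
      apply Rinv_le_contravar; [lra|].
      rewrite <- (pow_1 (INR N + 1)) at 1. apply Rle_pow; [lra|lia].
Qed.

Lemma is_series_RtoC (f : nat -> R) (l : R) : is_series f l ->
  is_series (V := C_R_NormedModule) (fun n => RtoC (f n)) (RtoC l).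
Proof.
  intro H.
  apply (filterlim_ext (fun n => RtoC (sum_n f n))).
  { induction x as [|n IH].
    - now rewrite !sum_O.
    - rewrite !sum_Sn, <- IH. change (@plus C_R_NormedModule) with Cplus.
      apply RtoC_plus. }
  apply (filterlim_comp _ _ _ (sum_n f) RtoC eventually (locally l) _ H).
  intros P [eps HP]. exists eps. intros y Hy. apply HP.
  split; [exact Hy|]. apply (ball_center (M := R_UniformSpace)).
Qed.

(** The diagonal entry at [J] is [4/beta] times the tail from [J] of the sum of
    [n b_n^2]. *)
Lemma mathieu_K_trace (beta : R) (b : Z -> C) : decays 6 b ->
  (forall n, Im (b n) = 0) ->
  is_trace (mathieu_K beta b)
    (RtoC (4 / beta *
           Series (fun n => (INR n + 1) ^ 2 * Re (b (Z.of_nat (S n))) ^ 2))).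
Proof.
  intros Hb6 Hreal.
  pose (c := fun n : nat => Re (b (Z.of_nat (S n)))).
  pose (a := fun n : nat => (INR n + 1) * c n ^ 2).
  assert (Hbc : forall n, b (Z.of_nat (S n)) = RtoC (c n)).
  { intro n. unfold c. rewrite (surjective_pairing (b (Z.of_nat (S n)))) at 1.
    unfold RtoC, Re. f_equal. apply Hreal. }
  assert (Hent : forall j, entry (mathieu_K beta b) j j
            = RtoC (4 / beta * Series (fun m => a (j + m)%nat))).
  { intro j. rewrite mathieu_K_entry by exact Hb6.
    rewrite (CSeries_ext _ (fun m => RtoC (2 * a (j + m)%nat))).
    - rewrite CSeries_RtoC, <- RtoC_mult, Series_scal_l. f_equal. unfold Rdiv. ring.
    - intro m. replace (idx j + Z.of_nat m)%Z with (Z.of_nat (S (j + m)))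
        by (unfold idx; lia).
      rewrite Hbc, <- !RtoC_mult. f_equal. unfold a.
      replace (idx j + idx j + 2 * Z.of_nat m)%Z with (2 * Z.of_nat (S (j + m)))%Z
        by (unfold idx; lia).
      rewrite mult_IZR, <- INR_IZR_INZ, S_INR. ring. }
  destruct Hb6 as (A & HA & H).
  assert (Ha : forall n, Rabs (a n) <= A * A / (INR n + 2) ^ 5).
  { intro n. unfold a. pose proof (pos_INR n) as Hn.
    assert (Hc : Rabs (c n) <= A / (INR n + 2) ^ 6).
    { unfold c. eapply Rle_trans; [apply re_le_Cmod|].
      eapply Rle_trans; [apply H|]. rewrite S_INR.
      replace (INR n + 1 + 1) with (INR n + 2) by ring. apply Rle_refl. }
    assert (Hc1 : Rabs (c n) <= A).
    { eapply Rle_trans; [exact Hc|].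
      apply Rle_div_l; [apply pow_lt; lra|].
      rewrite <- (Rmult_1_r A) at 1. apply Rmult_le_compat_l; [exact HA|].
      apply pow_R1_Rle; lra. }
    rewrite Rabs_mult, (Rabs_pos_eq (INR n + 1)), <- RPow_abs by lra.
    apply Rle_trans with ((INR n + 2) * (A * (A / (INR n + 2) ^ 6))).
    - apply Rmult_le_compat; try lra; [apply pow2_ge_0|].
      replace (Rabs (c n) ^ 2) with (Rabs (c n) * Rabs (c n)) by ring.
      apply Rmult_le_compat; try apply Rabs_pos; assumption.
    - right. field. lra. }
  pose proof (is_series_tails a (A * A) (Rmult_le_pos _ _ HA HA) Ha) as Ht.
  apply (is_series_scal_l (V := R_NormedModule) (4 / beta)) in Ht.
  apply is_series_RtoC in Ht.
  rewrite (Series_ext _ (fun n => (INR n + 1) * a n))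
    by (intro n; unfold a, c; ring).
  apply (is_series_ext (V := C_R_NormedModule) _ _ _ (fun n => eq_sym (Hent n))).
  exact Ht.
Qed.

(** * Fourier coefficients of a Mathieu function *)

Lemma cos_shift_multiple (n : Z) (x : R) : cos (IZR n * (2 * PI) + x) = cos x.
Proof.
  assert (Hnat : forall (k : nat) y, cos (INR k * (2 * PI) + y) = cos y).
  { intros k y. rewrite <- (cos_period y k). f_equal. ring. }
  destruct (Z_le_gt_dec 0 n) as [H|H].
  - rewrite <- (Z2Nat.id n H), <- INR_IZR_INZ. apply Hnat.
  - rewrite <- (Hnat (Z.to_nat (- n)) (IZR n * (2 * PI) + x)).
    f_equal. rewrite INR_IZR_INZ, Z2Nat.id, opp_IZR by lia. ring.
Qed.

Lemma sin_shift_multiple (n : Z) (x : R) : sin (IZR n * (2 * PI) + x) = sin x.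
Proof.
  rewrite <- (cos_shift (IZR n * (2 * PI) + x)), <- (cos_shift x).
  rewrite <- (cos_shift_multiple (- n) (PI / 2 - x)). f_equal.
  rewrite opp_IZR. ring.
Qed.

Lemma ex_RInt_derivable (f : R -> R) (a b : R) :
  (forall t, ex_derive f t) -> ex_RInt f a b.
Proof.
  intro H. apply (ex_RInt_continuous (V := R_CompleteNormedModule)).
  intros z _. apply (ex_derive_continuous (V := R_NormedModule)), H.
Qed.

Ltac derivable := intro; auto_derive; repeat apply conj; auto.

(** Equations typed in a module structure carried by [R] are restated in [R]. *)
Ltac eq_R := lazymatch goal with |- ?x = ?y => change (@eq R x y) end.
Ltac ring_R := eq_R; ring.

Lemma RInt_derivative_periodic (G g : R -> R) (p : R) :
  (forall t, is_derive G t (g t)) -> (forall t, ex_derive g t) ->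
  G p = G 0 -> RInt g 0 p = 0.
Proof.
  intros HG Hg Hp. apply is_RInt_unique.
  replace 0 with (minus (G p) (G 0)) at 2.
  - apply (is_RInt_derive (V := R_CompleteNormedModule)).
    + intros t _. apply HG.
    + intros t _. apply (ex_derive_continuous (V := R_NormedModule)), Hg.
  - rewrite Hp. apply (minus_eq_zero (G := R_AbelianGroup)).
Qed.

(** The phase [s] treats both parts of a Fourier coefficient at once: [s = 0]
    gives the integral against [cos nt] and [s = PI / 2] the one against
    [- sin nt]. *)
Definition moment (f : R -> R) (n : Z) (s : R) : R :=
  RInt (fun t => f t * cos (IZR n * t + s)) 0 (2 * PI).

Lemma moment_bound (f : R -> R) (n : Z) (s : R) :
  (forall t, ex_derive f t) ->
  Rabs (moment f n s) <= RInt (fun t => Rabs (f t)) 0 (2 * PI).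
Proof.
  intro Hf. pose proof PI_RGT_0.
  assert (Hfc : forall t, ex_derive (fun t => f t * cos (IZR n * t + s)) t).
  { derivable. }
  assert (Habs : forall h : R -> R, (forall t, ex_derive h t) ->
            ex_RInt (fun t => Rabs (h t)) 0 (2 * PI)).
  { intros h Hh. apply (ex_RInt_continuous (V := R_CompleteNormedModule)).
    intros z _. apply (continuous_comp h Rabs); [|apply continuous_Rabs].
    apply (ex_derive_continuous (V := R_NormedModule)), Hh. }
  eapply Rle_trans.
  - apply abs_RInt_le; [lra|]. now apply ex_RInt_derivable.
  - apply RInt_le; [lra| | |].
    + now apply Habs.
    + now apply Habs.
    + intros t _. rewrite Rabs_mult.
      rewrite <- (Rmult_1_r (Rabs (f t))) at 2.
      apply Rmult_le_compat_l; [apply Rabs_pos|].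
      apply Rabs_le; apply COS_bound.
Qed.

Definition mathieu_potential (alpha beta : R) (u : R -> R) (t : R) : R :=
  (alpha + beta * cos t) * u t.

Lemma potential_derivable (alpha beta : R) (u : R -> R) :
  (forall t, ex_derive u t) -> forall t, ex_derive (mathieu_potential alpha beta u) t.
Proof.
  intro Hu. unfold mathieu_potential. derivable.
Qed.

(** Multiplication by [cos t] shifts the frequency by one in both directions. *)
Lemma moment_potential (alpha beta : R) (u : R -> R) (n : Z) (s : R) :
  (forall t, ex_derive u t) ->
  moment (mathieu_potential alpha beta u) n s
  = alpha * moment u n s
    + beta / 2 * (moment u (n - 1) s + moment u (n + 1) s).
Proof.
  intro Hu.
  assert (Hex : forall m, ex_RInt (fun t => u t * cos (IZR m * t + s)) 0 (2 * PI)).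
  { intro m. apply ex_RInt_derivable. derivable. }
  assert (Hpt : forall t, mathieu_potential alpha beta u t * cos (IZR n * t + s)
    = alpha * (u t * cos (IZR n * t + s))
      + beta / 2 * (u t * cos (IZR (n - 1) * t + s) + u t * cos (IZR (n + 1) * t + s))).
  { intro t. unfold mathieu_potential. rewrite minus_IZR, plus_IZR.
    replace ((IZR n - 1) * t + s) with (IZR n * t + s - t) by ring.
    replace ((IZR n + 1) * t + s) with (IZR n * t + s + t) by ring.
    rewrite (cos_minus (IZR n * t + s)), (cos_plus (IZR n * t + s) t). field. }
  unfold moment at 1. apply is_RInt_unique.
  apply (is_RInt_ext (fun t => alpha * (u t * cos (IZR n * t + s))
      + beta / 2 * (u t * cos (IZR (n - 1) * t + s) + u t * cos (IZR (n + 1) * t + s)))).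
  { intros t _. now rewrite Hpt. }
  apply (is_RInt_plus (V := R_NormedModule)).
  - apply (is_RInt_scal (V := R_NormedModule)). apply (RInt_correct (V := R_CompleteNormedModule)), Hex.
  - apply (is_RInt_scal (V := R_NormedModule)).
    apply (is_RInt_plus (V := R_NormedModule));
    apply (RInt_correct (V := R_CompleteNormedModule)), Hex.
Qed.

Section Mathieu.

Variables (alpha beta : R) (u : R -> R).
Hypothesis u_mathieu : mathieu_solution alpha beta u.
Hypothesis u_periodic : periodic (2 * PI) u.

Let w := mathieu_potential alpha beta u.

Lemma u_derivable (t : R) : ex_derive u t.
Proof. apply u_mathieu. Qed.

Lemma u_derive (t : R) : is_derive u t (Derive u t).
Proof. apply Derive_correct, u_derivable. Qed.

Lemma u_second_derive (t : R) : is_derive (Derive u) t (- w t).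
Proof.
  destruct u_mathieu as (_ & Hd & He).
  replace (- w t) with (Derive (Derive u) t)
    by (specialize (He t); unfold w, mathieu_potential; lra).
  apply Derive_correct, Hd.
Qed.

Lemma Derive_second (t : R) : Derive (fun x => Derive u x) t = - w t.
Proof. exact (is_derive_unique _ _ _ (u_second_derive t)). Qed.

Lemma Derive_periodic : Derive u (2 * PI) = Derive u 0.
Proof.
  symmetry. apply is_derive_unique.
  apply (is_derive_ext (fun t => u (t + 2 * PI))); [apply u_periodic|].
  pose proof (u_derive (2 * PI)) as H.
  replace (2 * PI) with (0 + 2 * PI) in H at 1 by ring.
  assert (Hs : is_derive (fun t => t + 2 * PI) 0 1) by (auto_derive; [exact I|ring]).
  pose proof (is_derive_comp u (fun t => t + 2 * PI) 0 _ _ H Hs) as Hc.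
  unfold scal in Hc; simpl in Hc. unfold mult in Hc; simpl in Hc.
  now rewrite Rmult_1_l in Hc.
Qed.

Lemma u_at_period : u (2 * PI) = u 0.
Proof. rewrite <- (u_periodic 0). f_equal. ring. Qed.

(** Integrating by parts twice moves the second derivative onto the
    cosine; by periodicity of [u] and its derivative no boundary term is left. *)
Lemma moment_second_derivative (n : Z) (s : R) :
  IZR n ^ 2 * moment u n s = moment w n s.
Proof.
  pose (g := fun t => IZR n ^ 2 * (u t * cos (IZR n * t + s)) - w t * cos (IZR n * t + s)).
  assert (Hu := u_derivable).
  assert (Hw : forall t, ex_derive w t) by (apply potential_derivable, Hu).
  assert (H0 : RInt g 0 (2 * PI) = 0).
  { apply (RInt_derivative_periodic (fun t =>
      Derive u t * cos (IZR n * t + s) + IZR n * u t * sin (IZR n * t + s))).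
    - intro t. unfold g. auto_derive.
      + repeat apply conj; auto; eexists; apply u_second_derive.
      + rewrite Derive_second. change (Derive (fun x : R => u x) t) with (Derive u t). ring.
    - unfold g. derivable.
    - rewrite Derive_periodic, u_at_period, cos_shift_multiple, sin_shift_multiple.
      now rewrite Rmult_0_r, Rplus_0_l. }
  assert (Hex1 : ex_RInt (fun t => u t * cos (IZR n * t + s)) 0 (2 * PI)).
  { apply ex_RInt_derivable. derivable. }
  assert (Hex2 : ex_RInt (fun t => w t * cos (IZR n * t + s)) 0 (2 * PI)).
  { apply ex_RInt_derivable. derivable. }
  assert (Hg : RInt g 0 (2 * PI) = IZR n ^ 2 * moment u n s - moment w n s).
  { apply is_RInt_unique. apply (is_RInt_minus (V := R_NormedModule)).
    - apply (is_RInt_scal (V := R_NormedModule)).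
      apply (RInt_correct (V := R_CompleteNormedModule)), Hex1.
    - apply (RInt_correct (V := R_CompleteNormedModule)), Hex2. }
  lra.
Qed.

Lemma moment_recurrence (n : Z) (s : R) :
  IZR n ^ 2 * moment u n s
  = alpha * moment u n s + beta / 2 * (moment u (n - 1) s + moment u (n + 1) s).
Proof.
  rewrite moment_second_derivative. apply moment_potential, u_derivable.
Qed.

(** Integrate [(u u')' = u'^2 - w u] over a period, with [u'' = - w]. *)
Lemma energy_identity :
  RInt (fun t => Rabs (Derive u t) ^ 2) 0 (2 * PI)
  = RInt (fun t => w t * u t) 0 (2 * PI).
Proof.
  assert (Hu := u_derivable).
  assert (Hw : forall t, ex_derive w t) by (apply potential_derivable, Hu).
  assert (Hdu : forall t, ex_derive (Derive u) t)
    by (intro t; eexists; apply u_second_derive).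
  assert (H0 : RInt (fun t => Derive u t ^ 2 - w t * u t) 0 (2 * PI) = 0).
  { apply (RInt_derivative_periodic (fun t => u t * Derive u t)).
    - intro t. auto_derive.
      + repeat apply conj; auto.
      + rewrite Derive_second. change (Derive (fun x : R => u x) t) with (Derive u t). ring.
    - derivable.
    - now rewrite Derive_periodic, u_at_period. }
  rewrite (RInt_ext _ (fun t => Derive u t ^ 2)) by (intros; apply pow2_abs).
  assert (Hg : RInt (fun t => Derive u t ^ 2 - w t * u t) 0 (2 * PI)
    = RInt (fun t => Derive u t ^ 2) 0 (2 * PI) - RInt (fun t => w t * u t) 0 (2 * PI)).
  { apply (RInt_minus (V := R_CompleteNormedModule));
      apply ex_RInt_derivable; derivable. }
  lra.
Qed.

(** * Parseval's identity *)

(** Here [u] has the cosine expansion [c_0 + 2 c_1 cos t + 2 c_2 cos 2t + ...],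
    which is the form that real Fourier coefficients force. *)
Variable c : nat -> R.
Hypothesis c_coef : forall n, moment u (Z.of_nat n) 0 = 2 * PI * c n.
Variable A : R.
Hypothesis A_pos : 0 <= A.
Hypothesis c_decay : forall n, Rabs (c n) <= A / (INR n + 1) ^ 6.
Hypothesis c_expansion : forall t, is_series
  (fun n => 2 * c (S n) * cos (INR (S n) * t)) (u t - c 0%nat).

Let partial (N : nat) (t : R) : R :=
  c 0%nat + sum_n (fun n => 2 * c (S n) * cos (INR (S n) * t)) N.

(** Rapid decay of the coefficients makes the pointwise convergence uniform,
    which justifies integrating the expansion term by term. *)
Lemma partial_error (N : nat) (t : R) :
  Rabs (u t - partial N t) <= 2 * A * inv_square_sum / (INR N + 1).
Proof.
  pose (d := fun n => 2 * c (S n) * cos (INR (S n) * t)).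
  assert (Hd : forall n, Rabs (d n) <= 2 * A / (INR n + 2) ^ 5).
  { intro n. pose proof (pos_INR n). unfold d.
    rewrite !Rabs_mult, (Rabs_pos_eq 2) by lra.
    assert (Hcos : Rabs (cos (INR (S n) * t)) <= 1) by (apply Rabs_le; apply COS_bound).
    assert (Hc : Rabs (c (S n)) <= A / (INR n + 2) ^ 5).
    { eapply Rle_trans; [apply c_decay|]. rewrite S_INR.
      unfold Rdiv. apply Rmult_le_compat_l; [exact A_pos|].
      apply Rinv_le_contravar; [apply pow_lt; lra|].
      replace (INR n + 1 + 1) with (INR n + 2) by ring.
      apply Rle_pow; [lra|lia]. }
    replace (2 * A / (INR n + 2) ^ 5) with (2 * (A / (INR n + 2) ^ 5) * 1)
      by (unfold Rdiv; ring).
    pose proof (Rabs_pos (c (S n))).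
    apply Rmult_le_compat; [lra|apply Rabs_pos|lra|exact Hcos]. }
  assert (HA : 0 <= 2 * A) by lra.
  destruct (Series_pow5_tail (fun m => d (S N + m)%nat) (2 * A) (S N) HA
              (fun m => Hd (S N + m)%nat)) as [_ Htail].
  pose proof (c_expansion t) as Hexp. fold d in Hexp.
  assert (Heq : u t - partial N t = Series (fun m => d (S N + m)%nat)).
  { pose proof (Series_incr_n d (S N) ltac:(lia) (ex_intro _ _ Hexp)) as Hs.
    rewrite (is_series_unique _ _ Hexp) in Hs. simpl pred in Hs.
    unfold partial. fold d. rewrite sum_n_Reals. lra. }
  rewrite Heq. eapply Rle_trans; [exact Htail|].
  unfold Rdiv. apply Rmult_le_compat_l.
  { apply Rmult_le_pos; [exact HA|apply inv_square_sum_pos]. }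
  pose proof (pos_INR N). rewrite S_INR.
  apply Rinv_le_contravar; [lra|].
  apply Rle_trans with ((INR N + 1 + 1) ^ 1); [lra|]. apply Rle_pow; [lra|lia].
Qed.

Lemma is_RInt_partial (N : nat) :
  is_RInt (fun t => w t * partial N t) 0 (2 * PI)
    (4 * PI * sum_n (fun n => (INR n + 1) ^ 2 * c (S n) ^ 2) N).
Proof.
  assert (Hu := u_derivable).
  assert (Hw : forall t, ex_derive w t) by (apply potential_derivable, Hu).
  assert (Hmode : forall n : nat,
    is_RInt (fun t => w t * cos (INR n * t)) 0 (2 * PI) (INR n ^ 2 * (2 * PI * c n))).
  { intro n. rewrite <- c_coef.
    assert (Heq := moment_second_derivative (Z.of_nat n) 0).
    rewrite <- INR_IZR_INZ in Heq. rewrite Heq. unfold moment.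
    rewrite <- INR_IZR_INZ.
    apply (is_RInt_ext (fun t => w t * cos (INR n * t + 0))).
    { intros t _. now rewrite Rplus_0_r. }
    apply (RInt_correct (V := R_CompleteNormedModule)), ex_RInt_derivable.
    derivable. }
  assert (Hterm : forall n : nat,
    is_RInt (fun t => w t * (2 * c (S n) * cos (INR (S n) * t))) 0 (2 * PI)
      (4 * PI * ((INR n + 1) ^ 2 * c (S n) ^ 2))).
  { intro n. rewrite <- S_INR.
    replace (4 * PI * (INR (S n) ^ 2 * c (S n) ^ 2))
      with (2 * c (S n) * (INR (S n) ^ 2 * (2 * PI * c (S n)))) by ring.
    apply (is_RInt_ext (fun t => 2 * c (S n) * (w t * cos (INR (S n) * t)))).
    { intros t _. ring_R. }
    apply (is_RInt_scal (V := R_NormedModule)), Hmode. }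
  induction N as [|N IH].
  - rewrite sum_O.
    apply (is_RInt_ext (fun t => c 0%nat * (w t * cos (INR 0 * t))
                                 + w t * (2 * c 1%nat * cos (INR 1 * t)))).
    { intros t _. unfold partial. rewrite sum_O. simpl (INR 0).
      rewrite Rmult_0_l, cos_0. ring_R. }
    replace (4 * PI * ((INR 0 + 1) ^ 2 * c 1%nat ^ 2))
      with (c 0%nat * (INR 0 ^ 2 * (2 * PI * c 0%nat))
            + 4 * PI * ((INR 0 + 1) ^ 2 * c 1%nat ^ 2)) by (simpl; ring).
    apply (is_RInt_plus (V := R_NormedModule)); [|apply Hterm].
    apply (is_RInt_scal (V := R_NormedModule)), Hmode.
  - rewrite sum_Sn. change plus with Rplus. rewrite Rmult_plus_distr_l.
    apply (is_RInt_ext (fun t => w t * partial N t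
                 + w t * (2 * c (S (S N)) * cos (INR (S (S N)) * t)))).
    { intros t _. unfold partial. rewrite sum_Sn. change plus with Rplus. ring_R. }
    apply (is_RInt_plus (V := R_NormedModule)); [exact IH|apply Hterm].
Qed.

(** Expanding [u], but not [w = - u''], in the integral of [w u] gives the
    squares of the derivative's coefficients without differentiating the series:
    the [n]-th mode of [w] carries the factor [n^2]. *)
Lemma parseval_derivative :
  RInt (fun t => Rabs (Derive u t) ^ 2) 0 (2 * PI)
  = 4 * PI * Series (fun n => (INR n + 1) ^ 2 * c (S n) ^ 2).
Proof.
  assert (Hu := u_derivable).
  assert (Hw : forall t, ex_derive w t) by (apply potential_derivable, Hu).
  pose proof PI_RGT_0 as HPI.
  rewrite energy_identity.
  pose (I := RInt (fun t => w t * u t) 0 (2 * PI) : R).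
  change (I = 4 * PI * Series (fun n => (INR n + 1) ^ 2 * c (S n) ^ 2)).
  assert (HI : is_RInt (fun t => w t * u t) 0 (2 * PI) I).
  { apply (RInt_correct (V := R_CompleteNormedModule)), ex_RInt_derivable.
    derivable. }
  pose (J := RInt (fun t => Rabs (w t)) 0 (2 * PI) : R).
  assert (HJ : is_RInt (fun t => Rabs (w t)) 0 (2 * PI) J).
  { apply (RInt_correct (V := R_CompleteNormedModule)).
    apply (ex_RInt_continuous (V := R_CompleteNormedModule)).
    intros z _. apply (continuous_comp w Rabs); [|apply continuous_Rabs].
    apply (ex_derive_continuous (V := R_NormedModule)), Hw. }
  set (s := sum_n (fun n => (INR n + 1) ^ 2 * c (S n) ^ 2)).
  assert (Herr : forall N, Rabs (4 * PI * s N - I)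
                           <= 2 * A * inv_square_sum * J / (INR N + 1)).
  { intro N.
    assert (Hd := is_RInt_minus (V := R_NormedModule) _ _ _ _ _ _ (is_RInt_partial N) HI).
    assert (Hb := is_RInt_scal (V := R_NormedModule) _ _ _
                    (2 * A * inv_square_sum / (INR N + 1)) _ HJ).
    replace (2 * A * inv_square_sum * J / (INR N + 1))
      with (2 * A * inv_square_sum / (INR N + 1) * J) by (unfold Rdiv; ring).
    refine (norm_RInt_le (V := R_NormedModule) _ _ 0 (2 * PI) _ _ _ _ Hd Hb); [lra|].
    intros t _. change (Rabs (w t * partial N t - w t * u t)
      <= 2 * A * inv_square_sum / (INR N + 1) * Rabs (w t)).
    replace (w t * partial N t - w t * u t) with (- (w t * (u t - partial N t))) by ring.
    rewrite Rabs_Ropp, Rabs_mult, Rmult_comm.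
    apply Rmult_le_compat_r; [apply Rabs_pos|apply partial_error]. }
  assert (Hlim0 : is_lim_seq (fun N => 4 * PI * s N - I) 0).
  { apply (is_lim_seq_bounded_inv _ (2 * A * inv_square_sum * J)), Herr. }
  assert (Hlim : is_lim_seq s (I / (4 * PI))).
  { apply (is_lim_seq_ext (fun N => / (4 * PI) * ((4 * PI * s N - I) + I))).
    { intro N. field. lra. }
    replace (Finite (I / (4 * PI))) with (Rbar_mult (/ (4 * PI)) (0 + I))
      by (simpl; f_equal; unfold Rdiv; ring).
    apply is_lim_seq_scal_l. apply is_lim_seq_plus'; [exact Hlim0|].
    apply is_lim_seq_const. }
  rewrite (is_series_unique _ _ Hlim). field. lra.
Qed.

End Mathieu.

(** * Consequences of the Fourier expansion *)

Lemma Re_fourier_limit (u : R -> R) (b : Z -> C) (t : R) :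
  fourier_expansion u b ->
  is_lim_seq (fun N => Re (fourier_partial b N t)) (u t).
Proof.
  intros [_ H].
  apply (filterlim_comp _ _ _ _ (fun z : C => Re z) _ _ _ (H t)).
  apply (continuous_fst (U := R_UniformSpace) (V := R_UniformSpace)).
Qed.

(** Each partial sum has period [2 PI], and pointwise limits are unique. *)
Lemma expansion_periodic (u : R -> R) (b : Z -> C) :
  fourier_expansion u b -> periodic (2 * PI) u.
Proof.
  intros H t.
  assert (H1 := Re_fourier_limit u b (t + 2 * PI) H).
  assert (H2 := Re_fourier_limit u b t H).
  apply (is_lim_seq_ext _ (fun N => Re (fourier_partial b N t))) in H1.
  - apply is_lim_seq_unique in H1. apply is_lim_seq_unique in H2.
    rewrite H1 in H2. now injection H2.
  - intro N. f_equal. apply sum_n_ext. intro m. cbv zeta. f_equal.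
    unfold cis. rewrite Rmult_plus_distr_l, Rplus_comm.
    now rewrite cos_shift_multiple, sin_shift_multiple.
Qed.

Lemma coefficient_moments (u : R -> R) (b : Z -> C) (n : Z) :
  (forall t, ex_derive u t) -> fourier_expansion u b ->
  b n = (/ (2 * PI) * moment u n 0, / (2 * PI) * moment u n (PI / 2)).
Proof.
  intros Hu [H _]. rewrite H.
  assert (Hex : forall s, ex_RInt (fun t => u t * cos (IZR n * t + s)) 0 (2 * PI)).
  { intro s. apply ex_RInt_derivable. derivable. }
  rewrite (is_RInt_unique (V := C_R_CompleteNormedModule) _ 0 (2 * PI)
             (moment u n 0, moment u n (PI / 2))).
  - unfold Cmult, RtoC. simpl. f_equal; ring.
  - apply (is_RInt_fct_extend_pair (U := R_NormedModule) (V := R_NormedModule)).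
    + apply (is_RInt_ext (fun t => u t * cos (IZR n * t + 0))).
      { intros t _. simpl. rewrite cos_neg, Rplus_0_r. ring_R. }
      apply (RInt_correct (V := R_CompleteNormedModule)), Hex.
    + apply (is_RInt_ext (fun t => u t * cos (IZR n * t + PI / 2))).
      { intros t _. simpl. rewrite sin_neg, cos_plus, cos_PI2, sin_PI2. ring_R. }
      apply (RInt_correct (V := R_CompleteNormedModule)), Hex.
Qed.

Lemma coefficient_recurrence (alpha beta : R) (u : R -> R) (b : Z -> C) :
  mathieu_solution alpha beta u -> fourier_expansion u b ->
  mathieu_recurrence alpha beta b.
Proof.
  intros Hu Hb n.
  assert (Hd : forall t, ex_derive u t) by apply Hu.
  assert (Hp := expansion_periodic u b Hb).
  rewrite !(coefficient_moments u b _ Hd Hb).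
  assert (H0 := moment_recurrence alpha beta u Hu Hp n 0).
  assert (H1 := moment_recurrence alpha beta u Hu Hp n (PI / 2)).
  apply (f_equal (Rmult (/ (2 * PI)))) in H0.
  apply (f_equal (Rmult (/ (2 * PI)))) in H1.
  unfold Cmult, Cplus, RtoC. cbn [fst snd]. f_equal.
  - transitivity (/ (2 * PI) * (IZR n ^ 2 * moment u n 0)); [ring|].
    rewrite H0. ring.
  - transitivity (/ (2 * PI) * (IZR n ^ 2 * moment u n (PI / 2))); [ring|].
    rewrite H1. ring.
Qed.

Lemma coefficient_bound (u : R -> R) (b : Z -> C) :
  (forall t, ex_derive u t) -> fourier_expansion u b ->
  exists M, forall n, Cmod (b n) <= M.
Proof.
  intros Hu Hb.
  exists (2 * (/ (2 * PI) * RInt (fun t => Rabs (u t)) 0 (2 * PI))). intro n.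
  pose proof PI_RGT_0 as HPI.
  assert (Hinv : 0 < / (2 * PI)) by (apply Rinv_0_lt_compat; lra).
  rewrite (coefficient_moments u b n Hu Hb).
  eapply Rle_trans; [apply Cmod_le_sum|]. cbn [Re Im fst snd].
  rewrite !Rabs_mult, (Rabs_pos_eq (/ (2 * PI))) by lra.
  assert (H0 := moment_bound u n 0 Hu). assert (H1 := moment_bound u n (PI / 2) Hu).
  apply (Rmult_le_compat_l (/ (2 * PI))) in H0; [|lra].
  apply (Rmult_le_compat_l (/ (2 * PI))) in H1; [|lra].
  lra.
Qed.

Lemma sum_n_first (f : nat -> R) (n : nat) :
  sum_n f (S n) = f 0%nat + sum_n (fun m => f (S m)) n.
Proof.
  induction n as [|n IH].
  - rewrite sum_Sn, !sum_O. reflexivity.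
  - rewrite sum_Sn, IH, (sum_Sn (fun m => f (S m))). change plus with Rplus.
    cbv beta. ring_R.
Qed.

Lemma sum_symmetric (g : Z -> R) (N : nat) :
  sum_n (fun m => g (Z.of_nat m - Z.of_nat (S N))%Z) (2 * S N)
  = g 0%Z + sum_n (fun n => g (Z.of_nat (S n)) + g (- Z.of_nat (S n))%Z) N.
Proof.
  assert (Hstep : forall N : nat,
    sum_n (fun m => g (Z.of_nat m - Z.of_nat (S N))%Z) (2 * S N)
    = sum_n (fun m => g (Z.of_nat m - Z.of_nat N)%Z) (2 * N)
      + (g (Z.of_nat (S N)) + g (- Z.of_nat (S N))%Z)).
  { intro M. replace (2 * S M)%nat with (S (S (2 * M))) by lia.
    rewrite sum_Sn, sum_n_first. change plus with Rplus.
    replace (Z.of_nat (S (S (2 * M))) - Z.of_nat (S M))%Z with (Z.of_nat (S M)) by lia.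
    replace (Z.of_nat 0 - Z.of_nat (S M))%Z with (- Z.of_nat (S M))%Z by lia.
    rewrite (sum_n_ext (fun m => g (Z.of_nat (S m) - Z.of_nat (S M))%Z)
               (fun m => g (Z.of_nat m - Z.of_nat M)%Z)).
    - ring_R.
    - intro m. f_equal. lia. }
  induction N as [|N IH].
  - rewrite Hstep. simpl (2 * 0)%nat. rewrite !sum_O. reflexivity.
  - rewrite Hstep, IH, (sum_Sn (fun n => _ + _)). change plus with Rplus. ring_R.
Qed.

Lemma Re_sum_n (f : nat -> C) (n : nat) :
  Re (sum_n f n) = sum_n (fun m => Re (f m)) n.
Proof.
  induction n as [|n IH].
  - now rewrite !sum_O.
  - rewrite !sum_Sn, <- IH. reflexivity.
Qed.

(** Since [u] is real, [b_(-n)] is conjugate to [b_n]; real coefficients are thus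
    even in [n], and the terms for [n] and [-n] combine into a cosine. *)
Lemma real_expansion (u : R -> R) (b : Z -> C) (t : R) :
  (forall t, ex_derive u t) -> fourier_expansion u b ->
  (forall n, Im (b n) = 0) ->
  is_series (fun n => 2 * Re (b (Z.of_nat (S n))) * cos (INR (S n) * t))
            (u t - Re (b 0%Z)).
Proof.
  intros Hu Hb Hreal.
  assert (Hsym : forall n, Re (b (- n)%Z) = Re (b n)).
  { intro n. rewrite !(coefficient_moments u b _ Hu Hb). cbn [Re fst]. f_equal.
    apply RInt_ext. intros x _. rewrite opp_IZR, !Rplus_0_r.
    now rewrite Ropp_mult_distr_l_reverse, cos_neg. }
  pose (g := fun n : Z => Re (b n) * cos (IZR n * t)).
  assert (Hpart : forall N,
    Re (fourier_partial b (S N) t)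
    = g 0%Z + sum_n (fun n => g (Z.of_nat (S n)) + g (- Z.of_nat (S n))%Z) N).
  { intro N. rewrite <- sum_symmetric. unfold fourier_partial.
    rewrite Re_sum_n. apply sum_n_ext. intro m. cbv zeta.
    pose proof (Hreal (Z.of_nat m - Z.of_nat (S N))%Z) as Hr.
    unfold g, Cmult, cis, Re, Im in *. cbn [fst snd]. rewrite Hr. ring_R. }
  pose proof (Re_fourier_limit u b t Hb) as Hlim.
  apply is_lim_seq_incr_1 in Hlim.
  apply (is_lim_seq_ext _ _ _ Hpart) in Hlim.
  assert (Hg : g 0%Z = Re (b 0%Z)).
  { unfold g. rewrite Rmult_0_l, cos_0. ring. }
  rewrite Hg in Hlim.
  change (is_lim_seq (sum_n (fun n => 2 * Re (b (Z.of_nat (S n))) * cos (INR (S n) * t)))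
            (u t - Re (b 0%Z))).
  apply (is_lim_seq_ext (fun N =>
    (Re (b 0%Z) + sum_n (fun n => g (Z.of_nat (S n)) + g (- Z.of_nat (S n))%Z) N)
    - Re (b 0%Z))).
  - intro N. unfold Rminus at 1. rewrite Rplus_comm, <- Rplus_assoc, Rplus_opp_l, Rplus_0_l.
    apply sum_n_ext. intro n. unfold g.
    rewrite Hsym, opp_IZR, <- INR_IZR_INZ, Ropp_mult_distr_l_reverse, cos_neg. ring_R.
  - apply is_lim_seq_minus'; [exact Hlim|apply is_lim_seq_const].
Qed.

(* The trace formula needs real coefficients b_n, i.e. u even: for odd u the
   b_n are purely imaginary and the trace has the opposite sign. *)
Theorem theorem5p1 (alpha beta : R) (u : R -> R) (b : Z -> C)
    (hbeta : beta <> 0)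
    (hu : mathieu_solution alpha beta u)
    (hper : periodic (2 * PI) u \/ periodic (4 * PI) u)
    (hb : fourier_expansion u b) :
  trace_class (mathieu_K beta b) /\
  ((forall n : Z, Im (b n) = 0) ->
   is_trace (mathieu_K beta b)
     (RtoC (1 / (beta * PI) *
            RInt (fun t => (Rabs (Derive u t)) ^ 2) 0 (2 * PI)))) /\
  (forall j k : nat, j <> k ->
     entry (mathieu_K beta b) j k =
     Cdiv (Cminus (Cmult (b (idx j - 1)%Z) (b (idx k)))
                  (Cmult (b (idx j)) (b (idx k - 1)%Z)))
          (RtoC (IZR (idx j - idx k)))).
Proof.
  assert (Hd : forall t, ex_derive u t) by apply hu.
  assert (Hp := expansion_periodic u b hb).
  assert (Hrec := coefficient_recurrence alpha beta u b hu hb).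
  destruct (coefficient_bound u b Hd hb) as [M HM].
  assert (Hb6 := recurrence_decays_6 alpha beta M b Hrec HM).
  split; [now apply mathieu_K_trace_class|]. split.
  - intro Hreal.
    replace (1 / (beta * PI) * RInt (fun t => Rabs (Derive u t) ^ 2) 0 (2 * PI))
      with (4 / beta * Series (fun n => (INR n + 1) ^ 2 * Re (b (Z.of_nat (S n))) ^ 2));
      [now apply mathieu_K_trace|].
    pose proof PI_RGT_0 as HPI.
    destruct Hb6 as (A & HA & HbA).
    assert (Hmoment : forall n : nat,
      moment u (Z.of_nat n) 0 = 2 * PI * Re (b (Z.of_nat n))).
    { intro n. rewrite (coefficient_moments u b _ Hd hb). cbn [Re fst]. field. lra. }
    rewrite (parseval_derivative alpha beta u hu Hp (fun n => Re (b (Z.of_nat n)))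
               Hmoment A HA
               (fun n => Rle_trans _ _ _ (re_le_Cmod _) (HbA n))
               (fun t => real_expansion u b t Hd hb Hreal)).
    field. split; [lra|exact hbeta].
  - intros j k Hjk. now apply (mathieu_K_off_diagonal alpha beta).
Qed.
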